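(* For $i=1,2$ let $(X_i,u_i)$ be a Cantor minimal system. The following are equivalent. (i) The group $\mathsf{F}(X_1,u_1)$ embeds into $\mathsf{F}(X_2,u_2)$. (ii) There exists an element $v\in \mathsf{F}(X_2,u_2)$ such that the system $(\mathrm{Supp}(v),v)$ factors onto $(X_1,u_1)$.
   Context: A Cantor minimal system $(X,u)$ consists of a space $X$ homeomorphic to the Cantor set and a homeomorphism $u$ of $X$ all of whose orbits are dense. Its topological full group $\mathsf{F}(X,u)$ is the group of all homeomorphisms $g$ of $X$ such that every point of $X$ has a neighbourhood on which $g$ coincides with some power $u^n$, $n\in\mathbb{Z}$. The support $\mathrm{Supp}(v)$ of $v\in\mathsf{F}(X,u)$ is the closure of the set of points moved by $v$; it is clopen and $v$-invariant. A system $(Y,v)$ factors onto $(X,u)$ if there is a continuous surjective map $q\colon Y\to X$ with $u\circ q=q\circ v$. *)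

(* Defs.v *)
From HB Require Import structures.
From mathcomp Require Import all_boot all_order all_algebra all_fingroup.
From mathcomp Require Import all_classical.
From mathcomp Require Import topology cantor.

Set Implicit Arguments.
Unset Strict Implicit.
Unset Printing Implicit Defensive.

Import GRing.Theory.

Local Open Scope classical_set_scope.

Definition homeomorphism (X Y : topologicalType) (f : X -> Y) : Prop :=
  continuous f /\
  exists g : Y -> X, [/\ continuous g, cancel f g & cancel g f].

Definition homeomorphic (X Y : topologicalType) : Prop :=
  exists f : X -> Y, homeomorphism f.

(* The group of self-homeomorphisms, with (g * h) x = g (h x). *)
Record homeo (X : topologicalType) := Homeo {
  homeo_fun :> X -> X;
  homeo_funP : `[< homeomorphism homeo_fun >] }.

HB.instance Definition _ (X : topologicalType) :=
  [isSub for @homeo_fun X].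
HB.instance Definition _ (X : topologicalType) :=
  [Choice of homeo X by <:].

Section homeo_group.
Variable X : topologicalType.
Implicit Types g h : homeo X.

Lemma homeoP g : homeomorphism g.
Proof. exact/asboolP/homeo_funP. Qed.

Lemma eq_homeo g h : g =1 h -> g = h.
Proof. by move=> gh; apply/val_inj/funext. Qed.

Fact homeo1_subproof : `[< homeomorphism (@id X) >].
Proof.
by apply/asboolP; split; [|exists id; split] => // x; exact: cvg_id.
Qed.
Definition homeo1 := Homeo homeo1_subproof.

Fact homeoM_subproof g h : `[< homeomorphism (g \o h) >].
Proof.
apply/asboolP; have [cg [g' [cg' gK g'K]]] := homeoP g.
have [ch [h' [ch' hK h'K]]] := homeoP h.
split; first by move=> x; apply: continuous_comp; [exact: ch|exact: cg].
exists (h' \o g'); split; [|exact: can_comp|exact: can_comp].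
by move=> x; apply: continuous_comp; [exact: cg'|exact: ch'].
Qed.
Definition homeoM g h := Homeo (homeoM_subproof g h).

Definition homeoV_fun g : X -> X := projT1 (cid (homeoP g).2).

Fact homeoV_subproof g : `[< homeomorphism (homeoV_fun g) >].
Proof.
apply/asboolP; rewrite /homeoV_fun; case: cid => /= g' [cg' gK g'K].
by split=> //; exists g; split=> //; case: (homeoP g).
Qed.
Definition homeoV g := Homeo (homeoV_subproof g).

Fact homeoMA : associative homeoM.
Proof. by move=> f g h; exact: eq_homeo. Qed.
Fact homeo1M : left_id homeo1 homeoM.
Proof. by move=> g; exact: eq_homeo. Qed.
Fact homeoM1 : right_id homeo1 homeoM.
Proof. by move=> g; exact: eq_homeo. Qed.
Fact homeoVM : left_inverse homeo1 homeoV homeoM.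
Proof.
move=> g; apply: eq_homeo => x /=; rewrite /homeoV_fun.
by case: cid => /= g' [_ gK _]; exact: gK.
Qed.
Fact homeoMV : right_inverse homeo1 homeoV homeoM.
Proof.
move=> g; apply: eq_homeo => x /=; rewrite /homeoV_fun.
by case: cid => /= g' [_ _ g'K]; exact: g'K.
Qed.

HB.instance Definition _ :=
  isGroup.Build (homeo X) homeoMA homeo1M homeoM1 homeoVM homeoMV.

End homeo_group.

Lemma homeo1E (X : topologicalType) (x : X) : (1%g : homeo X) x = x.
Proof. by []. Qed.

Lemma homeoME (X : topologicalType) (g h : homeo X) x :
  (g * h)%g x = g (h x).
Proof. by []. Qed.

Definition expgz (G : groupType) (g : G) (n : int) : G :=
  match n with
  | Posz m => (g ^+ m)%g
  | Negz m => (g ^- m.+1)%g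
  end.

Lemma expgzN (G : groupType) (g : G) n : expgz g (- n)%R = (expgz g n)^-1%g.
Proof.
by case: n => [[|n]|n] /=; rewrite ?expg0 ?invg1 ?invgK.
Qed.

Lemma expgzS (G : groupType) (g : G) n : expgz g (n + 1)%R = (expgz g n * g)%g.
Proof.
case: n => [n|[|n]].
- by rewrite -PoszD addn1 /= expgSr.
- by rewrite NegzE addNr /= expg1 mulVg.
- rewrite NegzE [Posz n.+2]intS opprD addrAC addNr add0r.
  by rewrite expgzN -[RHS]/((g ^- n.+2 * g)%g) expgS invgM mulgVK.
Qed.

Lemma expgzD (G : groupType) (g : G) m n :
  expgz g (m + n)%R = (expgz g m * expgz g n)%g.
Proof.
elim/int_rect: n => [|n IH|n IH].
- by rewrite addr0 mulg1.
- by rewrite intS [(1 + _)%R]addrC addrA !expgzS IH mulgA.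
- have nS : (- n.+1%:Z + 1 = - n%:Z)%R by rewrite intS opprD addrAC addNr add0r.
  by apply: (mulIg g); rewrite -mulgA -!expgzS -addrA nS IH.
Qed.

Definition orbitz (X : topologicalType) (u : homeo X) (x : X) : set X :=
  range (fun n : int => expgz u n x).

Definition cantor_minimal (X : topologicalType) (u : homeo X) : Prop :=
  homeomorphic X cantor_space /\ forall x, dense (orbitz u x).

Definition locally_power (X : topologicalType) (u g : homeo X) : Prop :=
  forall x : X, exists n : int, \forall y \near x, g y = expgz u n y.

Record full_group (X : topologicalType) (u : homeo X) := FullGroup {
  full_group_val :> homeo X;
  full_group_valP : full_group_val \in [pred g | `[< locally_power u g >]] }.

HB.instance Definition _ (X : topologicalType) (u : homeo X) :=
  [isSub for @full_group_val X u].
HB.instance Definition _ (X : topologicalType) (u : homeo X) :=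
  [Choice of full_group u by <:].

Fact full_group_closed (X : topologicalType) (u : homeo X) :
  group_closed [pred g | `[< locally_power u g >]].
Proof.
split; first by apply/asboolP => x; exists 0%R; exact: nearW.
move=> g h /asboolP gP /asboolP hP; apply/asboolP => x.
have [n gn] := gP (h^-1%g x); have [m hm] := hP (h^-1%g x).
exists (n - m)%R.
have [/(_ x) cV _] := homeoP h^-1%g.
have gnx : \forall y \near x, g (h^-1%g y) = expgz u n (h^-1%g y) := cV _ gn.
have hmx : \forall y \near x, h (h^-1%g y) = expgz u m (h^-1%g y) := cV _ hm.
apply: filterS2 gnx hmx => y gy hy.
have yE : y = expgz u m (h^-1%g y) by rewrite -hy -[LHS](homeo1E y) -(mulgV h).
rewrite expgzD expgzN -[LHS]/(g (h^-1%g y)) gy -[RHS]/(expgz u n _).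
by congr (homeo_fun _ _); rewrite [in RHS]yE -homeoME mulVg.
Qed.

HB.instance Definition _ (X : topologicalType) (u : homeo X) :=
  SubChoice_isSubGroup.Build (homeo X) _ (full_group u) (full_group_closed u).

Definition group_embeds (G H : groupType) : Prop :=
  exists f : {multiplicative G -> H}, injective f.

Definition Supp (X : topologicalType) (v : homeo X) : set X :=
  closure [set x | v x <> x].

Lemma Supp_stable (X : topologicalType) (v : homeo X) x :
  Supp v x -> Supp v (v x).
Proof.
have [cv [w [cw vK wK]]] := homeoP v.
move=> sx B /cv /sx [y [vy By]]; exists (v y); split=> //.
by move=> /(can_inj vK).
Qed.

(* v as a self-map of its support, the latter with the subspace topology. *)
Definition Supp_map (X : topologicalType) (v : homeo X) (x : Supp v) : Supp v :=
  exist _ (v (val x)) (mem_set (Supp_stable (set_valP x))).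

Arguments Supp_map {X} v x.

Definition factors_onto (Y X : topologicalType) (v : Y -> Y) (u : X -> X) : Prop :=
  exists q : Y -> X,
    [/\ continuous q, set_surj [set: Y] [set: X] q & u \o q =1 q \o v].

(* Main.v *)
Require Import Defs.
From HB Require Import structures.
From mathcomp Require Import all_boot all_order all_algebra all_classical.
From mathcomp Require Import topology cantor.
From mathcomp Require Import zify.

Set Implicit Arguments.
Unset Strict Implicit.
Unset Printing Implicit Defensive.

Import Order.TTheory GRing.Theory Num.Theory.

Local Open Scope classical_set_scope.
Local Open Scope ring_scope.

(** One direction is a direct construction. If [q] maps [Supp v] onto [X1] and
    intertwines [v] with [u1], an element [g] of the full group of [u1] acts
    near [q y] as a power [u1 ^ n]; let it act near [y] as [v ^ n], and
    trivially off [Supp v]. Freeness of [u1] makes [n] unambiguous and turns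
    composition into addition of exponents ([embedding_of_factor]).

    For the converse let [rho] be an embedding, and for [y] in [X2] let
    [stab y] be the subgroup of those [g] for which [rho g] fixes [y]. The
    point is to recover a point [q y] of [X1] from [stab y]. This rests on
    the fact that an orbit of [u2] is a copy of the integers on which every
    element of the full group has bounded displacement: there is no room for
    two independent commuting motions. Indeed, if [a] and [b] commute, the
    [K ^ 2] points [a ^ i (b ^ j z)] with [i, j < K] lie in an interval of
    length [O(K)] of the orbit of [z], so two of them coincide, with [K] not
    depending on [z] ([commuting_collision]).

    Apply this to the return maps [a] and [b] of two disjoint clopen sets [U]
    and [V], and take a common multiple [M] of all exponents that may occur.
    Say that an element is in [U] if it is supported in [U]. Either every
    conjugate of [b ^ M] by an element in [V] lies in [stab y]; or, at some
    translate of [y] by an element in [V], every conjugate of [a ^ M] by an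
    element in [U] moves the point along its [b]-orbit. A subgroup that
    contains all these conjugates contains all small 3-cycles located in [V],
    respectively [U], by the double commutator argument ([germ3_normal]); in
    the second case, the elements that commute with [b] and move a point along
    its [b]-orbit form a group which is abelian modulo the stabilizer,
    whereas a 3-cycle is a commutator of 3-cycles, so that these 3-cycles fix
    the point. Hence [stab y] contains all small 3-cycles located in [U], or
    all those located in [V] ([germ3_on_dichotomy]).

    A finite combinatorial argument inside alternating groups deduces that
    [stab y] contains all small 3-cycles away from a single point [q y]
    ([germ3_off_point]), and that this point is unique unless [stab y]
    contains all small 3-cycles ([germ3_on_two_points]). The set [Y] of those
    [y] for which it does not is clopen and invariant, and [q] is continuous
    and equivariant on [Y]. Since [q] intertwines [rho u1] with the
    fixed-point free [u1], the element [v] which is [rho u1] on [Y] and the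
    identity elsewhere has support [Y], and [q] maps [Y] onto [X1] by
    compactness and minimality ([factor_of_embedding]). *)

(** * Powers of a homeomorphism and its topological full group *)

Section Powers.
Variables (X : topologicalType) (u : homeo X).
Local Notation pw := (expgz u).

Lemma pwD m n x : pw (m + n) x = pw m (pw n x).
Proof. by rewrite expgzD. Qed.

Lemma pw0 x : pw 0 x = x.
Proof. by []. Qed.

Lemma pwNK n : cancel (pw n) (pw (- n)).
Proof. by move=> x; rewrite -pwD addNr. Qed.

Lemma pwKN n : cancel (pw (- n)) (pw n).
Proof. by move=> x; rewrite -pwD addrN. Qed.

Lemma homeo_continuous (g : homeo X) : continuous g.
Proof. by have [] := homeoP g. Qed.

Lemma homeo_inj (g : homeo X) : injective g.
Proof. by have [_ [g' [_ gK _]]] := homeoP g; exact: can_inj gK. Qed.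

Lemma homeoK (g : homeo X) : cancel g (g^-1)%g.
Proof. by move=> x; rewrite -homeoME mulVg. Qed.

Lemma homeoVK (g : homeo X) : cancel (g^-1)%g g.
Proof. by move=> x; rewrite -homeoME mulgV. Qed.

Lemma near_pw n x (P : X -> Prop) :
  (\forall y \near pw n x, P y) -> \forall y \near x, P (pw n y).
Proof. exact: homeo_continuous. Qed.

Lemma clopen_setC (A : set X) : clopen A -> clopen (~` A).
Proof. exact: (clopenC set0). Qed.

Lemma clopen_preim (g : homeo X) A : clopen A -> clopen (g @^-1` A).
Proof.
move=> clA; apply: preimage_clopen => //.
exact: homeo_continuous.
Qed.

Lemma locally_power_pw n : locally_power u (pw n).
Proof. by move=> x; exists n; exact: nearW. Qed.

Definition full_pw n : full_group u :=
  FullGroup (mem_set (locally_power_pw n) : pw n \in [pred g | `[< locally_power u g >]]).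

Lemma full_groupP (g : full_group u) : locally_power u g.
Proof. exact/asboolP/(full_group_valP g). Qed.

Lemma full_groupE (g : full_group u) x : exists n, g x = pw n x.
Proof. by have [n /nbhs_singleton] := full_groupP g x; exists n. Qed.

Lemma eq_full (g h : full_group u) : g =1 h -> g = h.
Proof. by move=> gh; apply/val_inj/eq_homeo. Qed.

(** The inverse of a bijection that is locally a power of [u] is continuous
    because it is locally a power of [u] too. *)
Lemma full_of_fun (f f' : X -> X) : cancel f f' -> cancel f' f ->
  (forall x : X, exists n, \forall y \near x, f y = pw n y) ->
  exists g : full_group u, g =1 f.
Proof.
move=> fK f'K lf.
have cf : continuous f.
  move=> x O; have [n fn] := lf x.
  have fx := nbhs_singleton fn; rewrite fx => /near_pw O_.
  by rewrite /= nbhs_simpl; apply: filterS2 fn O_ => y /= ->.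
have cf' : continuous f'.
  move=> y; have [n fn] := lf (f' y).
  have fn' := nbhs_singleton fn; rewrite f'K in fn'.
  have {}fn : \forall z \near y, f (pw (- n) z) = z.
    have : \forall z \near pw (- n) y, f z = pw n z by rewrite fn' pwNK.
    by move/near_pw; apply: filterS => z ->; rewrite pwKN.
  move=> O; rewrite -[f' y](pwNK n) -fn' => /near_pw O_.
  by rewrite /= nbhs_simpl; apply: filterS2 fn O_ => z fz Oz; rewrite /= -fz fK.
have hf : `[< homeomorphism f >] by apply/asboolP; split=> //; exists f'.
have lF : Homeo hf \in [pred g | `[< locally_power u g >]] by apply/asboolP.
by exists (FullGroup lF).
Qed.

Lemma near_all_seq (T : eqType) (F : set_system X) (s : seq T)
    (P : T -> X -> Prop) : Filter F ->
  (forall i, i \in s -> \forall x \near F, P i x) ->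
  \forall x \near F, forall i, i \in s -> P i x.
Proof.
move=> FF; elim: s => [|i s IH] H; first by apply: nearW.
have H0 : \forall x \near F, P i x by apply: H; rewrite mem_head.
have H1 : \forall x \near F, forall i, i \in s -> P i x.
  by apply: IH => j js; apply: H; rewrite inE js orbT.
by apply: filterS2 H0 H1 => x Pi Ps j; rewrite inE => /predU1P[->|/Ps].
Qed.

End Powers.

(** * Cantor spaces and freeness of minimal systems *)

Section CantorSpace.
Variables (X : topologicalType) (hX : homeomorphic X cantor_space).

Lemma cantor_compact : compact [set: X].
Proof.
have [f [cf [g [cg fK gK]]]] := hX.
have <- : g @` setT = setT.
  by apply/seteqP; split=> // x _; exists (f x).
apply: continuous_compact cantor_space_compact.
exact: continuous_subspaceT.
Qed.

Lemma cantor_zero_dim : zero_dimensional X.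
Proof.
have [f [cf [g [cg fK gK]]]] := hX => x y xy.
have fxy : f x != f y by rewrite (can_eq fK).
have [U [clU Ux Uy]] := cantor_zero_dimensional fxy.
exists (f @^-1` U); split=> //; exact: preimage_clopen.
Qed.

Lemma cantor_hausdorff : hausdorff_space X.
Proof.
rewrite open_hausdorff => x y /cantor_zero_dim [A [[oA cA] Ax Ay]].
exists (A, ~` A); rewrite /= ?inE; split=> //.
- exact: closed_openC.
- by rewrite setICr.
Qed.

Lemma cantor_no_isolated (x : X) : ~ open [set x].
Proof.
have [f [cf [g [cg fK gK]]]] := hX => ox.
have /perfectTP/(_ (f x)) := cantor_perfect; apply.
have -> : [set f x] = g @^-1` [set x].
  by apply/seteqP; split=> y /= => [->|<-].
by apply: open_comp => // y _; exact: cg.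
Qed.

Lemma clopen_nbhs (x : X) (O : set X) : nbhs x O ->
  exists A, [/\ clopen A, A x & A `<=` O].
Proof.
move=> Ox.
have := zero_dimensional_cvg cantor_hausdorff cantor_zero_dim cantor_compact.
by move=> /(_ x O Ox) [A [Ax clA] AO]; exists A.
Qed.

Lemma near_clopen (x : X) (A : set X) : clopen A -> A x ->
  \forall y \near x, A y.
Proof. by move=> [oA _] Ax; apply: open_nbhs_nbhs. Qed.

End CantorSpace.

Section Minimal.
Variables (X : topologicalType) (u : homeo X) (hu : cantor_minimal u).
Local Notation pw := (expgz u).

Lemma min_dense (A : set X) x : open A -> A !=set0 -> exists n, A (pw n x).
Proof.
move=> oA A0; have [_ /(_ x) dx] := hu.
by have [y [Ay [n _ ny]]] := dx _ A0 oA; exists n; rewrite ny.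
Qed.

Lemma pw_mul n x k : pw n x = x -> pw (k * n) x = x.
Proof.
move=> nx.
have H (j : nat) : pw (j%:Z * n) x = x.
  by elim: j => [|j IH]; rewrite ?mul0r // intS mulrDl mul1r pwD IH.
case: k => k; rewrite ?NegzE ?mulNr //.
by rewrite -[in LHS](H k.+1) pwNK.
Qed.

(** A finite orbit is closed, so that if it is dense it is the whole space and
    all points are isolated. Freeness is what makes the exponent of an element
    of the full group well defined, and its germs determined by values. *)
Lemma pw_free n x : pw n x = x -> n = 0.
Proof.
have H k : pw k.+1%:Z x = x -> False.
  move=> kx; have [hX _] := hu.
  have fin_closed (s : seq X) : closed [set` s].
    apply: (accessible_finite_set_closed.1 _ _ (finite_seq s)).
    exact: hausdorff_accessible (cantor_hausdorff hX).
  pose s := [seq pw i%:Z x | i <- iota 0 k.+1].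
  have sT m : pw m x \in s.
    rewrite (divz_eq m k.+1) addrC pwD (pw_mul _ kx).
    have := modz_ge0 m (isT : k.+1%:Z != 0).
    have := ltz_pmod m (isT : 0 < k.+1%:Z).
    case: (m %% k.+1)%Z => // j jk _; apply/mapP; exists j => //.
    by rewrite mem_iota.
  have allT y : y \in s.
    apply: contrapT => /negP ys.
    have [|m /=] := @min_dense (~` [set` s]) x (closed_openC (fin_closed s)).
      by exists y; apply/negP.
    exact.
  apply: (@cantor_no_isolated _ hX x).
  have -> : [set x] = ~` [set` [seq y <- s | y != x]].
    move: s allT {sT} => s allT.
    apply/seteqP; split=> y; rewrite /setC /= mem_filter allT andbT.
      by move=> ->; rewrite eqxx.
    by move/negP; rewrite negbK => /eqP.
  exact/closed_openC/fin_closed.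
case: n => [[|n]|n] //; first by move/H.
rewrite NegzE => nx; have [] := H n.
by rewrite -[in LHS]nx pwKN.
Qed.

Lemma pw_inj x : injective (fun n => pw n x).
Proof.
move=> m n /= mn; apply/eqP; rewrite -subr_eq0; apply/eqP/(@pw_free _ (pw n x)).
by rewrite -pwD subrK.
Qed.

End Minimal.

(** * Properties of small sets around a point *)

Section Small.
Variables (X : topologicalType) (x : X).

(** All subsets of the neighbourhood are quantified over, including those that
    miss [x]: pieces of a partition of a clopen set into small sets need not
    contain a prescribed point. *)
Definition small (P : set X -> Prop) :=
  exists2 W, nbhs x W & forall A, A `<=` W -> P A.

Lemma small_and P Q : small P -> small Q -> small (fun A => P A /\ Q A).
Proof.
move=> [V xV PV] [W xW QW]; exists (V `&` W); first exact: filterI.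
by move=> A; rewrite subsetI => -[/PV ? /QW ?].
Qed.

Lemma small_mono (P Q : set X -> Prop) :
  small P -> (forall A, P A -> Q A) -> small Q.
Proof. by move=> [V xV PV] PQ; exists V => // A /PV /PQ. Qed.

Lemma small_all (T : eqType) (s : seq T) (P : T -> set X -> Prop) :
  (forall i, i \in s -> small (P i)) ->
  small (fun A => forall i, i \in s -> P i A).
Proof.
elim: s => [|i s IH] H; first by exists setT; first exact: filterT.
have /(small_and (H i (mem_head _ _))) [W xW PW] :
  small (fun A => forall j, j \in s -> P j A).
  by apply: IH => j js; apply: H; rewrite inE js orbT.
exists W => // A /PW [Pi Ps] j; rewrite inE => /predU1P[->//|/Ps//].
Qed.

Lemma small_clopen P : homeomorphic X cantor_space -> small P ->
  exists A, [/\ clopen A, A x & forall B, B `<=` A -> P B].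
Proof.
move=> hX [W /(clopen_nbhs hX) [A [clA Ax AW]] PW]; exists A; split=> // B BA.
exact/PW/(subset_trans BA).
Qed.

End Small.

(** * Small 3-cycles *)

(** The integers moved here are the indices of the levels of a tower. *)
Definition cycle3 (i j k n : int) :=
  if n == i then j else if n == j then k else if n == k then i else n.

(** Turns a hypothesis [uniq] on top of the goal into disequalities. *)
Ltac distinct :=
  rewrite /= ?inE ?negb_or ?andbT -?andbA;
  repeat (let H := fresh in case/andP => /eqP H);
  try (let H := fresh in move/eqP => H).

Lemma cycle3_fst i j k : cycle3 i j k i = j.
Proof. by rewrite /cycle3 eqxx. Qed.

Lemma cycle3_snd i j k : j <> i -> cycle3 i j k j = k.
Proof. by rewrite /cycle3 eqxx => /eqP/negPf->. Qed.

Lemma cycle3_trd i j k : k <> i -> k <> j -> cycle3 i j k k = i.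
Proof. by rewrite /cycle3 eqxx => /eqP/negPf-> /eqP/negPf->. Qed.

Lemma cycle3_oth i j k n : n <> i -> n <> j -> n <> k -> cycle3 i j k n = n.
Proof. by rewrite /cycle3 => /eqP/negPf-> /eqP/negPf-> /eqP/negPf->. Qed.

(** Evaluates compositions of 3-cycles from the inside out, on variables that
    the context shows to be distinct. *)
Ltac cycle3_eval := rewrite /=;
  repeat match goal with |- context [cycle3 ?i ?j ?k ?n] =>
    is_var n;
    first [rewrite (cycle3_fst i j k) | rewrite (@cycle3_snd i j k); [|congruence]
          | rewrite (@cycle3_trd i j k); [|congruence|congruence]
          | rewrite (@cycle3_oth i j k n); [|congruence|congruence|congruence]]
  end.

Ltac uniq_from H :=
  move: H; clear; distinct; repeat (apply/andP; split);
  apply/eqP; congruence.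

Lemma cycle3K i j k : uniq [:: i; j; k] -> cancel (cycle3 i j k) (cycle3 k j i).
Proof.
distinct => n; have [->|ni] := eqVneq n i; first by cycle3_eval.
have [->|nj] := eqVneq n j; first by cycle3_eval.
have [->|nk] := eqVneq n k; first by cycle3_eval.
by rewrite !cycle3_oth //; exact/eqP.
Qed.

Lemma cycle3_in (s : seq int) i j k n :
  i \in s -> j \in s -> k \in s -> n \in s -> cycle3 i j k n \in s.
Proof. by rewrite /cycle3; do 3?[case: eqP => _]. Qed.

Lemma cycle3_out i j k n : n \notin [:: i; j; k] -> cycle3 i j k n = n.
Proof. by rewrite /cycle3 !inE !negb_or => /and3P[/negPf-> /negPf-> /negPf->]. Qed.

Section Tower.
Variables (X : topologicalType) (u : homeo X).
Local Notation pw := (expgz u).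

(** Disjointness of the levels [u ^ n A], for [n] in [s], stated on points. *)
Definition tower (s : seq int) (A : set X) :=
  forall a b m n, A a -> A b -> m \in s -> n \in s -> pw m a = pw n b -> m = n.

(** Over a tower, identities between permutations of the index set [s] become
    identities between elements of the full group, as such a [g] is determined
    by [sigma]. *)
Definition moves_tower (s : seq int) (sigma : int -> int) (A : set X)
    (g : X -> X) :=
  (forall a n, A a -> n \in s -> g (pw n a) = pw (sigma n) a) /\
  (forall x, (forall n, n \in s -> ~ A (pw (- n) x)) -> g x = x).

Lemma sub_tower s t A B : {subset t <= s} -> B `<=` A -> tower s A -> tower t B.
Proof.
move=> ts BA tA a b m n /BA Aa /BA Ab /ts ms /ts ns; exact: tA.
Qed.

Lemma moves_towerM s sigma tau A (g h : full_group u) :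
  (forall n, n \in s -> tau n \in s) ->
  moves_tower s sigma A g -> moves_tower s tau A h ->
  moves_tower s (sigma \o tau) A (g * h)%g.
Proof.
move=> ts [gs gx] [hs hx]; split=> [a n Aa ns|x xA].
  by rewrite -[LHS]/(g (h _)) hs // gs // ts.
by rewrite -[LHS]/(g (h _)) hx ?gx.
Qed.

Lemma moves_towerV s sigma tau A (g : full_group u) :
  (forall n, n \in s -> tau n \in s) -> {in s, cancel tau sigma} ->
  moves_tower s sigma A g -> moves_tower s tau A (g^-1)%g.
Proof.
move=> ts tK [gs gx]; split=> [a n Aa ns|x xA].
  by rewrite -[n in LHS]tK // -gs ?ts //; apply: homeoK.
by rewrite -[in LHS](gx _ xA); apply: homeoK.
Qed.

Lemma moves_tower_uniq s sigma tau A (g h : full_group u) :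
  {in s, sigma =1 tau} ->
  moves_tower s sigma A g -> moves_tower s tau A h -> g = h.
Proof.
move=> st [gs gx] [hs hx]; apply: eq_full => x.
have [[n ns An]|H] := pselect (exists2 n, n \in s & A (pw (- n) x)).
  by rewrite -(pwKN u n x) gs // hs // st.
by rewrite gx ?hx // => n ns An; apply: H; exists n.
Qed.

(** Any finite set of levels may be added to a 3-cycle; this brings several
    3-cycles to a common tower, in which they can be composed. *)
Lemma moves_tower_widen s i j k A (g : X -> X) : tower s A ->
  i \in s -> j \in s -> k \in s ->
  moves_tower [:: i; j; k] (cycle3 i j k) A g <-> moves_tower s (cycle3 i j k) A g.
Proof.
move=> tA si sj sk.
have sub : {subset [:: i; j; k] <= s}.
  by move=> n; rewrite !inE => /or3P[] /eqP->.
split=> -[gs gx]; split=> [a n Aa ns|x xA].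
- case: (boolP (n \in [:: i; j; k])) => nijk; first exact: gs.
  rewrite cycle3_out // gx // => m mijk Am; have := sub _ mijk => ms.
  have mn : m = n by apply: (tA _ a _ _ Am Aa) => //; rewrite pwKN.
  by rewrite -mn mijk in nijk.
- by rewrite gx // => n /sub; apply: xA.
- by rewrite gs // sub.
- have [[n ns An]|H] := pselect (exists2 n, n \in s & A (pw (- n) x)).
    rewrite -(pwKN u n x) gs // cycle3_out //.
    by apply/negP => /xA.
  by rewrite gx // => n ns An; apply: H; exists n.
Qed.

Section Exists.
Variables (s : seq int) (A : set X).
Hypotheses (clA : clopen A) (tA : tower s A).

Let shuffle (sigma : int -> int) (x : X) : X :=
  if pselect (exists n, n \in s /\ A (pw (- n) x)) is left e
  then pw (sigma (projT1 (cid e)) - projT1 (cid e)) x else x.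

Let shuffleE sigma n x : n \in s -> A (pw (- n) x) ->
  shuffle sigma x = pw (sigma n - n) x.
Proof.
move=> ns An; rewrite /shuffle; case: pselect => [e|]; last by case; exists n.
case: cid => m /= [ms Am]; suff -> : m = n by [].
by apply: (tA Am An) => //; rewrite !pwKN.
Qed.

Let shuffle_out sigma x : (forall n, n \in s -> ~ A (pw (- n) x)) ->
  shuffle sigma x = x.
Proof.
by rewrite /shuffle => H; case: pselect => // -[n [ns An]]; case: (H n ns).
Qed.

Let shuffle_spec sigma : moves_tower s sigma A (shuffle sigma).
Proof.
split=> [a n Aa ns|x]; last exact: shuffle_out.
by rewrite (shuffleE _ ns) ?pwNK // -pwD subrK.
Qed.

Let shuffleK sigma tau : (forall n, n \in s -> sigma n \in s) ->
  {in s, cancel sigma tau} -> cancel (shuffle sigma) (shuffle tau).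
Proof.
move=> ss sK x.
have [[n ns An]|H] := pselect (exists2 n, n \in s & A (pw (- n) x)).
  have [gs _] := shuffle_spec sigma; have [ht _] := shuffle_spec tau.
  by rewrite -[x](pwKN u n) gs // ht ?sK ?ss.
by rewrite !shuffle_out // => n ns An; apply: H; exists n.
Qed.

Lemma moves_tower_exists sigma tau : (forall n, n \in s -> sigma n \in s) ->
  (forall n, n \in s -> tau n \in s) ->
  {in s, cancel sigma tau} -> {in s, cancel tau sigma} ->
  exists g : full_group u, moves_tower s sigma A g.
Proof.
move=> ss ts sK tK.
have [|g gE] := @full_of_fun _ u _ _ (shuffleK ss sK) (shuffleK ts tK).
  move=> x.
  have [[n ns An]|H] := pselect (exists2 n, n \in s & A (pw (- n) x)).
    exists (sigma n - n).
    have : \forall y \near x, A (pw (- n) y).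
      exact: (near_clopen (clopen_preim _ clA)).
    by apply: filterS => y; exact: shuffleE.
  exists 0; have : \forall y \near x, forall n, n \in s -> ~ A (pw (- n) y).
    apply: near_all_seq => n ns; apply: (near_clopen (A := ~` (pw (- n) @^-1` A))).
      exact/clopen_setC/clopen_preim.
    by move=> An; apply: H; exists n.
  by apply: filterS => y; exact: shuffle_out.
by exists g; split=> [a n Aa ns|x xA]; rewrite gE; case: (shuffle_spec sigma); auto.
Qed.

End Exists.

Lemma cycle3_exists s i j k A : clopen A -> tower s A -> uniq [:: i; j; k] ->
  i \in s -> j \in s -> k \in s ->
  exists g : full_group u, moves_tower s (cycle3 i j k) A g.
Proof.
move=> clA tA ijk si sj sk.
apply: (@moves_tower_exists s A clA tA _ (cycle3 k j i)) => n ns.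
- exact: cycle3_in.
- exact: cycle3_in.
- exact: cycle3K.
- by apply: cycle3K; rewrite -rev_uniq.
Qed.

Lemma cycle3_inv s i j k A (g : full_group u) : uniq [:: i; j; k] ->
  i \in s -> j \in s -> k \in s ->
  moves_tower s (cycle3 i j k) A g -> moves_tower s (cycle3 k j i) A (g^-1)%g.
Proof.
move=> ijk si sj sk; apply: moves_towerV => n ns; first exact: cycle3_in.
by apply: cycle3K; rewrite -rev_uniq.
Qed.

(** In an alternating group, two 3-cycles with one common point have a 3-cycle
    as commutator. *)
Lemma cycle3_commutator a b c d e A (f g h : full_group u) :
  uniq [:: a; b; c; d; e] ->
  moves_tower [:: a; b; c; d; e] (cycle3 a b c) A f ->
  moves_tower [:: a; b; c; d; e] (cycle3 c d e) A g ->
  moves_tower [:: a; b; c; d; e] (cycle3 a d c) A h ->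
  (f * g * f^-1 * g^-1)%g = h.
Proof.
set t := [:: a; b; c; d; e] => u5 mf mg mh.
have [ta tb tc td te] : [/\ a \in t, b \in t, c \in t, d \in t & e \in t].
  by rewrite !inE !eqxx !orbT.
have abc : uniq [:: a; b; c] by uniq_from u5.
have cde : uniq [:: c; d; e] by uniq_from u5.
have mfV := cycle3_inv abc ta tb tc mf.
have mgV := cycle3_inv cde tc td te mg.
have mM := moves_towerM (fun n => cycle3_in te td tc)
  (moves_towerM (fun n => cycle3_in tc tb ta)
    (moves_towerM (fun n => cycle3_in tc td te) mf mg) mfV) mgV.
apply: moves_tower_uniq mM mh => n /=.
by rewrite !inE => /or4P[|||/orP[]] /eqP->; move: u5; clear; distinct; cycle3_eval.
Qed.

End Tower.

Lemma small_sep (X : topologicalType) (hX : homeomorphic X cantor_space)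
  (f g : homeo X) x : f x <> g x ->
  small x (fun A => forall a b, A a -> A b -> f a <> g b).
Proof.
move=> /eqP /(cantor_zero_dim hX) [C [clC Cf Cg]].
exists (f @^-1` C `&` ~` (g @^-1` C)).
  apply: (near_clopen (A := _ `&` _)); last by split.
  by apply: clopenI; [|apply: clopen_setC]; exact: clopen_preim.
by move=> A AW a b /AW[Ca _] /AW[_ Cb] ab; case: Cb; rewrite /= -ab.
Qed.

Lemma small_tower (X : topologicalType) (u : homeo X) (hu : cantor_minimal u)
  s x : small x (tower u s).
Proof.
have H : small x (fun A => forall mn, mn \in [seq (m, n) | m <- s, n <- s] ->
    forall a b, A a -> A b -> expgz u mn.1 a = expgz u mn.2 b -> mn.1 = mn.2).
  apply: small_all => -[m n] _ /=.
  have [->|/eqP mn] := eqVneq m n; first by exists setT => //; exact: filterT.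
  apply: small_mono (small_sep hu.1 (f := expgz u m) (g := expgz u n) _) _.
    by move/(pw_inj hu).
  by move=> A AW a b Aa Ab /(AW _ _ Aa Ab).
apply: small_mono H _ => A H a b m n Aa Ab ms ns.
by apply: (H (m, n)) => //; apply/allpairsP; exists (m, n).
Qed.

Lemma small_within (X : topologicalType) (u : homeo X) (s : seq int) U x :
  clopen U -> (forall n, n \in s -> U (expgz u n x)) ->
  small x (fun A => forall n, n \in s -> forall y, A y -> U (expgz u n y)).
Proof.
move=> clU sU; apply: small_all => n ns.
exists (expgz u n @^-1` U); last by move=> A AW y /AW.
exact: near_clopen (clopen_preim _ clU) (sU _ ns).
Qed.

Section Germs.
Variables (X : topologicalType) (u : homeo X) (hu : cantor_minimal u).
Local Notation pw := (expgz u).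
Local Notation G := (full_group u).

(** A classical set, as stabilizers have no boolean membership test. *)
Record subgroup (H : set G) : Prop := Subgroup {
  subgroup1 : H 1%g;
  subgroupM : forall g h, H g -> H h -> H (g * h)%g;
  subgroupV : forall g, H g -> H (g^-1)%g }.

(** For fixed [H] and [x], a relation on triples of distinct points [u ^ i x],
    [u ^ j x], [u ^ k x] of one orbit, which behaves like membership of the
    3-cycle [(i j k)] in a permutation group. *)
Definition germ3 (H : set G) x i j k := small x (fun A => clopen A ->
  forall c : G, moves_tower u [:: i; j; k] (cycle3 i j k) A c -> H c).

Lemma moves_tower_ext s t sigma tau A (g : X -> X) :
  s =i t -> {in s, sigma =1 tau} ->
  moves_tower u s sigma A g -> moves_tower u t tau A g.
Proof.
move=> st sg [gs gx]; split=> [a n Aa nt|x xA].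
  by rewrite gs ?sg ?st.
by apply: gx => n; rewrite st; exact: xA.
Qed.

Lemma germ3_rot H x i j k : uniq [:: i; j; k] ->
  germ3 H x i j k -> germ3 H x j k i.
Proof.
move=> ijk h; apply: small_mono h _ => A h clA c cm; apply: h => //.
apply: moves_tower_ext cm => n.
  by rewrite !inE; case: (n == i); case: (n == j); case: (n == k).
by rewrite !inE => /or3P[] /eqP->; move: ijk; distinct; cycle3_eval.
Qed.

Lemma germ3_inv H x i j k : subgroup H -> uniq [:: i; j; k] ->
  germ3 H x i j k -> germ3 H x k j i.
Proof.
move=> sH ijk h; apply: small_mono h _ => A h clA c cm.
rewrite -[c]invgK; apply: (subgroupV sH); apply: h => //.
have kji : uniq [:: k; j; i] by uniq_from ijk.
have [si sj sk] : [/\ i \in [:: i; j; k], j \in [:: i; j; k] & k \in [:: i; j; k]].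
  by rewrite !inE !eqxx !orbT.
apply: (cycle3_inv kji sk sj si); apply: moves_tower_ext cm => n //.
by rewrite !inE; case: (n == i); case: (n == j); case: (n == k).
Qed.

(** This is the identity [(q r s)^-1 (p r s) (q r s) = (p q r)]. *)
Lemma germ3_trans H x p q r s : subgroup H -> uniq [:: p; q; r; s] ->
  germ3 H x p r s -> germ3 H x q r s -> germ3 H x p q r.
Proof.
move=> sH pqrs h1 h2.
apply: small_mono (small_and (small_and h1 h2) (small_tower hu [:: p; q; r; s] x)) _.
move=> A [[{}h1 {}h2] tA] clA c; move: pqrs; set t := [:: p; q; r; s] => pqrs.
have [tp tq tr ts] : [/\ p \in t, q \in t, r \in t & s \in t].
  by rewrite !inE !eqxx !orbT.
have prs : uniq [:: p; r; s] by uniq_from pqrs.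
have qrs : uniq [:: q; r; s] by uniq_from pqrs.
have [c1 m1] := cycle3_exists clA tA prs tp tr ts.
have [c2 m2] := cycle3_exists clA tA qrs tq tr ts.
have m2V := cycle3_inv qrs tq tr ts m2.
move=> /(moves_tower_widen _ tA tp tq tr) m.
have <- : (c2^-1 * c1 * c2)%g = c.
  have mM := moves_towerM (fun n => cycle3_in tq tr ts)
    (moves_towerM (fun n => cycle3_in tp tr ts) m2V m1) m2.
  apply: moves_tower_uniq mM m => n /=.
  by rewrite !inE => /or4P[] /eqP->; move: pqrs; clear; distinct; cycle3_eval.
have Hc1 : H c1 by apply: h1 => //; apply/(moves_tower_widen _ tA).
have Hc2 : H c2 by apply: h2 => //; apply/(moves_tower_widen _ tA).
by apply: (subgroupM sH) => //; apply: (subgroupM sH) => //; apply: (subgroupV sH).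
Qed.

(** 3-cycles are commutators of 3-cycles, so they survive the passage from [H]
    to any [S] that contains the commutators of [H]. *)
Lemma germ3_comm H S x a b c d e : uniq [:: a; b; c; d; e] ->
  (forall g h, H g -> H h -> S (g * h * g^-1 * h^-1)%g) ->
  germ3 H x a b c -> germ3 H x c d e -> germ3 S x a d c.
Proof.
move=> abcde HS h1 h2.
apply: small_mono (small_and (small_and h1 h2) (small_tower hu [:: a; b; c; d; e] x)) _.
move=> A [[{}h1 {}h2] tA] clA g; move: abcde; set t := [:: a; b; c; d; e] => u5.
have [ta tb tc td te] : [/\ a \in t, b \in t, c \in t, d \in t & e \in t].
  by rewrite !inE !eqxx !orbT.
have abc : uniq [:: a; b; c] by uniq_from u5.
have cde : uniq [:: c; d; e] by uniq_from u5.
have [c1 m1] := cycle3_exists clA tA abc ta tb tc.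
have [c2 m2] := cycle3_exists clA tA cde tc td te.
move=> /(moves_tower_widen _ tA ta td tc) m.
have <- := cycle3_commutator u5 m1 m2 m.
by apply: HS; [apply: h1|apply: h2] => //; apply/(moves_tower_widen _ tA).
Qed.

(** The 3-cycles through a fixed pair of points generate the alternating
    group. *)
Lemma germ3_of_pair H x i j k s t : subgroup H -> uniq [:: i; j; k; s; t] ->
  germ3 H x i s t -> germ3 H x j s t -> germ3 H x k s t -> germ3 H x i j k.
Proof.
move=> sH u5 hi hj hk.
have ijs : germ3 H x i j s.
  by apply: germ3_trans hi hj => //; uniq_from u5.
have kjs : germ3 H x k j s.
  apply: germ3_trans hk hj => //; uniq_from u5.
have ikj : germ3 H x i k j.
  by apply: germ3_trans ijs kjs => //; uniq_from u5.
have jki : germ3 H x j k i by apply: germ3_inv ikj => //; uniq_from u5.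
by apply: (germ3_rot _ (germ3_rot _ jki)); uniq_from u5.
Qed.

(** A 3-cycle over [A] is the product of the 3-cycles over the pieces of any
    finite partition of [A], and by compactness [A] has a partition into
    pieces whose 3-cycles belong to [H]. *)
Lemma germ3_glue H i j k A (c : G) : subgroup H -> uniq [:: i; j; k] ->
  clopen A -> tower u [:: i; j; k] A -> (forall x, A x -> germ3 H x i j k) ->
  moves_tower u [:: i; j; k] (cycle3 i j k) A c -> H c.
Proof.
move=> sH ijk clA tA hA cm; set s := [:: i; j; k] in tA cm.
have [si sj sk] : [/\ i \in s, j \in s & k \in s] by rewrite !inE !eqxx !orbT.
(* Compactness is used through the filter of sets that contain a good set:
   good sets are stable under union and locally cover [A]. *)
pose good W := clopen W /\ forall B, B `<=` W -> B `<=` A -> clopen B ->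
  forall g : G, moves_tower u s (cycle3 i j k) B g -> H g.
pose F : set_system (set X) := filter_from good (fun W => [set V | W `<=` V]).
have goodU V W : good V -> good W -> good (V `|` W).
  move=> [clV gV] [clW gW]; split; first exact: clopenU.
  move=> B BVW BA clB g gm.
  have clBV : clopen (B `&` V) by exact: clopenI.
  have clBW : clopen (B `&` ~` V) by apply: clopenI => //; apply: clopen_setC.
  have [g1 m1] : exists g : G, moves_tower u s (cycle3 i j k) (B `&` V) g.
    by apply: cycle3_exists => //; apply: sub_tower tA => // x [/BA].
  have [g2 m2] : exists g : G, moves_tower u s (cycle3 i j k) (B `&` ~` V) g.
    by apply: cycle3_exists => //; apply: sub_tower tA => // x [/BA].
  suff -> : g = (g1 * g2)%g.
    apply: (subgroupM sH).
      by apply: (gV _ _ _ clBV) m1 => x [] // /BA.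
    by apply: (gW _ _ _ clBW) m2 => x [] //; [move=> /BVW[]|move=> /BA].
  apply: eq_full => x; rewrite -[RHS]/(g1 (g2 x)).
  have sep (C D : set X) a n : C `<=` A -> D `<=` A -> C `&` D = set0 ->
      C a -> n \in s -> forall m, m \in s -> ~ D (pw (- m) (pw n a)).
    move=> CA DA CD Ca ns m ms Dm.
    have mn : m = n.
      by apply: (tA _ a _ _ _ _ ms ns); [exact: DA Dm|exact: CA|rewrite pwKN].
    have : (C `&` D) a by split=> //; rewrite mn pwNK in Dm.
    by rewrite CD.
  have VC : (B `&` V) `&` (B `&` ~` V) = set0.
    by rewrite setIACA setICr setI0.
  have sA C : B `&` C `<=` A by move=> y [/BA].
  have [[n ns Bn]|nB] := pselect (exists2 n, n \in s & B (pw (- n) x)); last first.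
    rewrite gm.2; last by move=> n ns Bn; apply: nB; exists n.
    rewrite m2.2; last by move=> n ns [Bn _]; apply: nB; exists n.
    by rewrite m1.2 // => n ns [Bn _]; apply: nB; exists n.
  rewrite -[x](pwKN u n); set a := pw (- n) x in Bn *.
  have [Va|Va] := pselect (V a).
    rewrite gm.1 // m2.2; last exact: (sep _ _ _ _ (sA _) (sA _) VC).
    by rewrite m1.1.
  rewrite gm.1 // m2.1 // m1.2 //.
  have C0 : (B `&` ~` V) `&` (B `&` V) = set0 by rewrite setIC.
  apply: (sep _ _ _ _ (sA _) (sA _) C0 (conj Bn Va)); exact: cycle3_in.
have good0 : good set0.
  split=> [|B]; first exact: clopen0.
  rewrite subset0 => -> _ _ g gm; suff -> : g = 1%g by exact: subgroup1.
  by apply: eq_full => x; rewrite gm.2 // => n _ [].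
have FF : Filter F.
  apply: filter_from_filter; first by exists set0.
  move=> V W gV gW; exists (V `|` W); first exact: goodU.
  by move=> Z; rewrite /= subUset.
have cA : compact A.
  by apply: (subclosed_compact _ (cantor_compact hu.1)) => //; case: clA.
have [x Ax|W [clW gW] /(_ W)] :=
  (compact_near_coveringP A).1 cA (set X) F (fun W x => W x) FF.
  have [B [clB Bx hB]] := small_clopen hu.1 (hA x Ax).
  exists (B, [set V | B `<=` V]); last by move=> [y V] /= [By BV]; exact: BV.
  split=> /=; first exact: near_clopen.
  by exists B => //; split=> // C CB _ clC g gm; apply: hB gm.
by move=> AW; apply: (gW A) => //; exact: AW.
Qed.

End Germs.

(** * Recurrence and return maps *)

Section Recurrence.
Variables (X : topologicalType) (u : homeo X) (hu : cantor_minimal u).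
Local Notation pw := (expgz u).
Local Notation G := (full_group u).

Lemma compact_bounded (Q : int -> X -> Prop) :
  (forall x : X, exists n, \forall y \near x, Q n y) ->
  exists N, forall x, exists n, (`|n| <= N)%N /\ Q n x.
Proof.
move=> HQ.
have [x _|N _ /(_ N) H] := (compact_near_coveringP _).1 (cantor_compact hu.1) nat
  \oo (fun N x => exists n, (`|n| <= N)%N /\ Q n x) _.
  have [n Qn] := HQ x.
  exists ([set y | Q n y], [set N | (`|n| <= N)%N]); last first.
    by move=> [y N] /= [Qy nN]; exists n.
  by split => //; exists `|n|%N.
by exists N => x; apply: H => //=.
Qed.

Lemma full_bounded (g : G) :
  exists N, forall x, exists n, (`|n| <= N)%N /\ g x = pw n x.
Proof. exact/compact_bounded/full_groupP. Qed.

Section Return.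
Variables (U : set X) (oU : open U) (U0 : U !=set0).

(** The time of a visit is locally constant, so compactness bounds it. *)
Lemma syndetic : exists N, forall x, exists n, (`|n| <= N)%N /\ U (pw n x).
Proof.
apply: compact_bounded => x; have [n Un] := min_dense hu x oU U0; exists n.
by apply: near_pw; exact: open_nbhs_nbhs.
Qed.

(** Two-sided density of orbits yields one-sided recurrence: apply the uniform
    bound to a point far enough along the orbit. *)
Lemma recurrent_gt K x : exists n, K < n /\ U (pw n x).
Proof.
have [N HN] := syndetic; have [n [nN Un]] := HN (pw (K + N%:Z + 1) x).
by exists (n + (K + N%:Z + 1)); rewrite pwD; split=> //; lia.
Qed.

Lemma recurrent_lt K x : exists n, n < K /\ U (pw n x).
Proof.
have [N HN] := syndetic; have [n [nN Un]] := HN (pw (K - N%:Z - 1) x).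
by exists (n + (K - N%:Z - 1)); rewrite pwD; split=> //; lia.
Qed.

(** Infinitely many points of an orbit lie in [U]. *)
Lemma fresh x (s : seq X) : exists n, U (pw n x) /\ pw n x \notin s.
Proof.
have [K HK] : exists K, forall n, K < n -> pw n x \notin s.
  elim: s => [|y s [K HK]]; first by exists 0.
  have [[m my]|ny] := pselect (exists m, pw m x = y).
    exists (Num.max m K) => n; rewrite gt_max inE negb_or => /andP[mn Kn].
    rewrite HK // andbT -my; apply/eqP => /(pw_inj hu) nm.
    by rewrite nm ltxx in mn.
  exists K => n Kn; rewrite inE negb_or HK // andbT.
  by apply/eqP => nx; apply: ny; exists n.
by have [n [/HK nK Un]] := recurrent_gt K x; exists n.
Qed.

(** Both directions [e = 1] and [e = -1] are considered since the two return
    maps are inverse to each other. *)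
Let is_ret (e : int) x (n : nat) :=
  [/\ (0 < n)%N, U (pw (e * n%:Z) x) &
      forall m : nat, (0 < m < n)%N -> ~ U (pw (e * m%:Z) x)].

Let is_ret_uniq e x m n : is_ret e x m -> is_ret e x n -> m = n.
Proof.
move=> [m0 Um mm] [n0 Un nn]; case: (ltngtP m n) => // H.
  by case: (nn m) => //; rewrite m0.
by case: (mm n) => //; rewrite n0.
Qed.

Let is_ret_exists e x : e = 1 \/ e = -1 -> exists n, is_ret e x n.
Proof.
move=> he.
have ex : exists n, (0 < n)%N && `[< U (pw (e * n%:Z) x) >].
  case: he => ->.
    have [[n|n] [n0 Un]] := recurrent_gt 0 x; last by [].
    by exists n; apply/andP; split=> //; apply/asboolP; rewrite mul1r.
  have [[n|n] [n0 Un]] := recurrent_lt 0 x; first by [].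
  by exists n.+1; apply/andP; split=> //; apply/asboolP; rewrite mulN1r -NegzE.
case: (ex_minnP ex) => n /andP[n0 /asboolP Un] nmin; exists n; split=> //.
move=> m /andP[m0 mn] Um; suff : (n <= m)%N by rewrite leqNgt mn.
by apply: nmin; rewrite m0; apply/asboolP.
Qed.

Let is_ret_rev e x n : U x -> is_ret e x n -> is_ret (- e) (pw (e * n%:Z) x) n.
Proof.
move=> Ux [n0 Un nn]; split=> //; first by rewrite -pwD mulNr addNr.
move=> m mn; rewrite -pwD mulNr -mulrN -mulrDr.
have -> : - m%:Z + n%:Z = (n - m)%N%:Z by lia.
by apply: nn; lia.
Qed.

Lemma first_return : closed U -> exists a : G,
  forall x, (~ U x -> a x = x) /\
    (U x -> U (a x) /\ exists2 n : nat, (0 < n)%N & a x = pw n%:Z x).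
Proof.
move=> cU.
have clU : clopen U by [].
have /choice [r rP] : forall ex : int * X, exists n,
    ex.1 = 1 \/ ex.1 = -1 -> is_ret ex.1 ex.2 n.
  move=> [e x] /=.
  have [he|] := pselect (e = 1 \/ e = -1); last by exists 0%N.
  by have [n rn] := is_ret_exists x he; exists n.
pose f e x := if `[< U x >] then pw (e * (r (e, x))%:Z) x else x.
have fU e x : U x -> f e x = pw (e * (r (e, x))%:Z) x by rewrite /f => /asboolP->.
have fN e x : ~ U x -> f e x = x by rewrite /f => /asboolPn/negPf->.
have fK e : e = 1 \/ e = -1 -> cancel (f e) (f (- e)).
  move=> he x; have [Ux|Ux] := pselect (U x); last by rewrite !fN.
  have rx := rP (e, x) he; rewrite /= in rx.
  have he' : - e = 1 \/ - e = -1 by case: he => ->; [right|left]; rewrite ?opprK.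
  rewrite (fU e) // fU; last by case: rx.
  rewrite (is_ret_uniq (rP (- e, _) he') (is_ret_rev Ux rx)).
  by rewrite mulNr pwNK.
have [||x|a aE] := @full_of_fun _ u (f 1) (f (-1)).
- by apply: fK; left.
- by have := @fK (-1); rewrite opprK; apply; right.
- have [Ux|Ux] := pselect (U x); last first.
    exists 0; have : \forall y \near x, (~` U) y.
      by apply: near_clopen => //; apply: clopen_setC.
    by apply: filterS => y; exact: fN.
  have h1 : (1 : int) = 1 \/ (1 : int) = -1 by left.
  have [r0 Ur rmin] := rP (1, x) h1; rewrite /= in r0 Ur rmin.
  exists (1 * (r (1, x))%:Z).
  have n1 : \forall y \near x, U y by exact: near_clopen.
  have n2 : \forall y \near x, U (pw (1 * (r (1, x))%:Z) y).
    by apply: near_pw; exact: near_clopen.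
  have n3 : \forall y \near x, forall m : nat, m \in iota 1 (r (1, x)).-1 ->
      (~` U) (pw (1 * m%:Z) y).
    apply: near_all_seq => m; rewrite mem_iota => mr; apply: near_pw.
    by apply: near_clopen; [apply: clopen_setC|apply: rmin; move: r0 mr; case: (r (1, x)) => // R; lia].
  apply: filterS3 n1 n2 n3 => y Uy Ury mUy; rewrite fU //.
  rewrite (@is_ret_uniq 1 y (r (1, y)) (r (1, x))) //; first exact: rP (1, y) h1.
  by split=> // m mr; apply: mUy; rewrite mem_iota; lia.
- exists a => x; split=> Ux; rewrite aE; first exact: fN.
  have [|r0 Ur _] := rP (1, x); first by left.
  by rewrite fU //; split=> //; exists (r (1, x)) => //; rewrite mul1r.
Qed.

End Return.

Definition supported (U : set X) (g : G) := forall x, ~ U x -> g x = x.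

(** All powers of the first return map move each point of [U] forward by a
    positive time, which freeness forbids to be a period. *)
Lemma return_map (U : set X) : clopen U -> exists a : G, supported U a /\
  forall n x, U x -> (a ^+ n.+1)%g x <> x.
Proof.
move=> [oU cU]; have [U0|U0] := pselect (U !=set0); last first.
  by exists 1%g; split=> // n x Ux; case: U0; exists x.
have [a aP] := first_return oU U0 cU; exists a; split=> [x|n x Ux].
  by case: (aP x).
have [k [n0 Un ->]] : exists k : nat, [/\ (0 < k)%N, U ((a ^+ n.+1)%g x) &
    (a ^+ n.+1)%g x = pw k%:Z x].
  elim: n => [|n [k [k0 Uk ak]]].
    by have [_ /(_ Ux) [Uax [k k0 ak]]] := aP x; exists k; rewrite expg1.
  have [_ /(_ Uk) [Uax [m m0 am]]] := aP ((a ^+ n.+1)%g x).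
  have aS : (a ^+ n.+2)%g x = a ((a ^+ n.+1)%g x) by rewrite expgS.
  exists (m + k)%N; rewrite aS; split=> //; first by rewrite addn_gt0 m0.
  by rewrite PoszD pwD -ak.
by move=> /(pw_free hu); lia.
Qed.

End Recurrence.

(** * Normal closures contain 3-cycles *)

Section NormalClosure.
Variables (X : topologicalType) (u : homeo X) (hu : cantor_minimal u).
Local Notation pw := (expgz u).
Local Notation G := (full_group u).

Lemma supportedV U (g : G) : supported U g -> supported U (g^-1)%g.
Proof. by move=> gU x /gU gx; rewrite -[in LHS]gx; exact: homeoK. Qed.

Lemma supportedM U (g h : G) : supported U g -> supported U h ->
  supported U (g * h)%g.
Proof. by move=> gU hU x Ux; rewrite -[LHS]/(g (h x)) hU ?gU. Qed.

(** A point moved by [g] is sent to a point moved by [g]. *)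
Lemma commute_disjoint (g h : G) :
  (forall x, g x = x \/ h x = x) -> (g * h = h * g)%g.
Proof.
move=> gh; apply: eq_full => x; rewrite -[LHS]/(g (h x)) -[RHS]/(h (g x)).
case: (gh x) => [gx|hx].
  case: (gh (h x)) => [ghx|]; first by rewrite gx.
  by move=> /homeo_inj hx; rewrite !(hx, gx).
case: (gh (g x)) => [|hgx]; last by rewrite hx hgx.
by move=> /homeo_inj gx; rewrite !(hx, gx).
Qed.

Lemma moves_tower_supported U s sigma A (g : G) :
  (forall a n, A a -> n \in s -> U (pw n a)) ->
  moves_tower u s sigma A g -> supported U g.
Proof.
move=> AU [_ gx] x Ux; apply: gx => n ns An; apply: Ux.
by rewrite -(pwKN u n x); exact: AU.
Qed.

Variables (H : set G) (sH : subgroup H) (U : set X) (clU : clopen U) (p : G).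
Hypothesis conjH : forall g, supported U g -> H (g * p * g^-1)%g.
Hypothesis p_free : forall x, U x -> p x <> x.

(** The commutator of [f] and [p] is [f f'] with [f' = p f^-1 p^-1], which lies in
    [H]. As [f'] commutes with [f] and [g], the commutators of [f] and of [f f']
    with [g] are equal; and the latter lies in [H] because conjugation by [g]
    permutes the conjugates of [p] by elements supported in [U]. *)
Let double_comm (f g : G) : supported U f -> supported U g ->
  commute (p * f^-1 * p^-1)%g f -> commute (p * f^-1 * p^-1)%g g ->
  H (f * g * f^-1 * g^-1)%g.
Proof.
move=> fU gU cf cg; set f' := (p * f^-1 * p^-1)%g in cf cg.
have Hconj k : supported U k -> H (k * f * p * f^-1 * p^-1 * k^-1)%g.
  move=> kU.
  have -> : (k * f * p * f^-1 * p^-1 * k^-1 =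
             (k * f) * p * (k * f)^-1 * (k * p * k^-1)^-1)%g.
    by rewrite !invgM !invgK !mulgA !mulgVK.
  by apply: (subgroupM sH); [|apply: (subgroupV sH)]; apply: conjH => //;
    exact: supportedM.
have -> : (f * g * f^-1 * g^-1 =
   (1 * f * p * f^-1 * p^-1 * 1^-1) * (g * f * p * f^-1 * p^-1 * g^-1)^-1)%g.
  have -> : (1 * f * p * f^-1 * p^-1 * 1^-1 = f * f')%g.
    by rewrite mul1g invg1 mulg1 /f' !mulgA.
  have -> : (g * f * p * f^-1 * p^-1 * g^-1 = g * (f * f') * g^-1)%g.
    by rewrite /f' !mulgA.
  clearbody f'; rewrite !invgM invgK !mulgA -(mulgA f f' g) cg.
  by rewrite !mulgA mulgK.
by apply: (subgroupM sH); [|apply: (subgroupV sH)]; apply: Hconj.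
Qed.

(** If [p] moves the whole tower off itself, [p f^-1 p^-1] is disjoint from the
    tower for all [f] that live on it. *)
Let germ3_displaced x a b c d e : uniq [:: a; b; c; d; e] ->
  (forall n, n \in [:: a; b; c; d; e] -> U (pw n x)) ->
  (forall m n, m \in [:: a; b; c; d; e] -> n \in [:: a; b; c; d; e] ->
     p (pw m x) <> pw n x) ->
  germ3 H x a d c.
Proof.
set t := [:: a; b; c; d; e] => u5 tU pt.
have smU := small_within clU tU.
have smp : small x (fun A => forall mn, mn \in [seq (m, n) | m <- t, n <- t] ->
    forall y z, A y -> A z -> p (pw mn.1 y) <> pw mn.2 z).
  apply: small_all => -[m n] /allpairsP[[m' n'] /= [mt nt [-> ->]]].
  exact: (small_sep hu.1 (f := (val p * pw m')%g) (pt _ _ mt nt)).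
apply: small_mono (small_and (small_and smU smp) (small_tower hu t x)) _.
move=> A [[{}smU {}smp] tA] clA g.
have [ta tb tc td te] : [/\ a \in t, b \in t, c \in t, d \in t & e \in t].
  by rewrite !inE !eqxx !orbT.
have abc : uniq [:: a; b; c] by uniq_from u5.
have cde : uniq [:: c; d; e] by uniq_from u5.
have [c1 m1] := cycle3_exists clA tA abc ta tb tc.
have [c2 m2] := cycle3_exists clA tA cde tc td te.
have m1V := cycle3_inv abc ta tb tc m1.
move=> /(moves_tower_widen _ tA ta td tc) m.
have <- := cycle3_commutator u5 m1 m2 m.
have UA y n : A y -> n \in t -> U (pw n y) by move=> Ay nt; exact: smU.
have comm (f : G) sigma : moves_tower u t sigma A f ->
    commute (p * c1^-1 * p^-1)%g f.
  move=> mf; apply: commute_disjoint => z.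
  have [[n nt An]|nz] := pselect (exists2 n, n \in t & A (pw (- n) z)); last first.
    by right; apply: mf.2 => n nt An; apply: nz; exists n.
  left; rewrite -[LHS]/(p ((c1^-1)%g ((p^-1)%g z))) m1V.2; first exact: homeoVK.
  move=> k kt Ak; apply: (smp (k, n) _ _ _ Ak An).
    by apply/allpairsP; exists (k, n).
  by rewrite /= !pwKN; exact: homeoVK.
apply: double_comm.
- exact: moves_tower_supported m1.
- exact: moves_tower_supported m2.
- exact: comm m1.
- exact: comm m2.
Qed.

Let displaced (x y : X) : Prop :=
  [/\ x <> y, p x <> y & p y <> x].

(** An arbitrary triple may be moved by [p] to a triple that meets it. It is
    reached from triples with two points [s] and [t] chosen so far away that
    [p] displaces everything involved; [b] and [e] provide the five points
    that are needed to write a 3-cycle as a commutator. *)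
Lemma germ3_normal x i j k : uniq [:: i; j; k] ->
  U (pw i x) -> U (pw j x) -> U (pw k x) -> germ3 H x i j k.
Proof.
move=> ijk Ui Uj Uk.
have oU : open U by case: clU.
have U0 : U !=set0 by exists (pw i x).
have fr (s : seq int) : exists n, U (pw n x) /\
    forall m, m \in s -> displaced (pw n x) (pw m x).
  have [n [Un ns]] := fresh hu oU U0 x
    (flatten [seq [:: pw m x; p (pw m x); (p^-1)%g (pw m x)] | m <- s]).
  exists n; split=> // m ms; split=> nm; move/negP: ns; apply.
  - by apply/flatten_mapP; exists m => //; rewrite nm mem_head.
  - apply/flatten_mapP; exists m => //; rewrite -nm.
    by rewrite [X in _ \in [:: _; _; X]]homeoK !inE eqxx !orbT.
  - by apply/flatten_mapP; exists m => //; rewrite -nm !inE eqxx orbT.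
have [s [Us ds]] := fr [:: i; j; k].
have [t [Ut dt]] := fr [:: i; j; k; s].
have step l : l \in [:: i; j; k] -> U (pw l x) -> germ3 H x l s t.
  move=> lijk Ul.
  have [b [Ub db]] := fr [:: l; s; t].
  have [e [Ue de]] := fr [:: l; s; t; b].
  have dis m n : displaced (pw m x) (pw n x) -> m <> n by move=> [+ _ _] mn; rewrite mn.
  have sl := ds l lijk.
  have tl : displaced (pw t x) (pw l x) by apply: dt; move: lijk; rewrite !inE => /or3P[]->; rewrite ?orbT.
  have ts : displaced (pw t x) (pw s x) by apply: dt; rewrite !inE eqxx !orbT.
  have [bl bs bt] : [/\ displaced (pw b x) (pw l x), displaced (pw b x) (pw s x)
     & displaced (pw b x) (pw t x)] by split; apply: db; rewrite !inE eqxx ?orbT.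
  have [el es et eb] : [/\ displaced (pw e x) (pw l x), displaced (pw e x) (pw s x),
     displaced (pw e x) (pw t x) & displaced (pw e x) (pw b x)].
    by split; apply: de; rewrite !inE eqxx ?orbT.
  apply: (@germ3_displaced x l b t s e).
  - have := (dis _ _ sl, dis _ _ tl, dis _ _ ts, dis _ _ bl, dis _ _ bs, dis _ _ bt).
    have := (dis _ _ el, dis _ _ es, dis _ _ et, dis _ _ eb).
    clear; case=> [[[? ?] ?] ?] [[[[[? ?] ?] ?] ?] ?].
    by rewrite /= !inE !negb_or andbT; repeat (apply/andP; split); apply/eqP; congruence.
  - by move=> n; rewrite !inE => /or4P[|||/orP[]] /eqP->.
  - move=> m n; rewrite !inE.
    case: sl tl ts bl bs bt el es et eb => ? ? ? [? ? ?] [? ? ?] [? ? ?] [? ? ?] [? ? ?] [? ? ?] [? ? ?] [? ? ?] [? ? ?].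
    by do 2 (case/or4P=> [|||/orP[]] /eqP->) => //; exact: p_free.
have u5 : uniq [:: i; j; k; s; t].
  have dis m n : displaced (pw m x) (pw n x) -> m <> n by move=> [+ _ _] mn; rewrite mn.
  have [/dis si /dis sj /dis sk] : [/\ displaced (pw s x) (pw i x),
    displaced (pw s x) (pw j x) & displaced (pw s x) (pw k x)].
    by split; apply: ds; rewrite !inE eqxx ?orbT.
  have [/dis ti /dis tj /dis tk /dis ts] : [/\ displaced (pw t x) (pw i x),
    displaced (pw t x) (pw j x), displaced (pw t x) (pw k x) & displaced (pw t x) (pw s x)].
    by split; apply: dt; rewrite !inE eqxx ?orbT.
  move: ijk; distinct.
  by repeat (apply/andP; split); apply/eqP; congruence.
by apply: (germ3_of_pair hu sH u5); apply: step => //; rewrite !inE eqxx ?orbT.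
Qed.

End NormalClosure.

(** * Commuting elements on an orbit *)

Section Displacement.
Variables (X : topologicalType) (u : homeo X) (hu : cantor_minimal u).
Local Notation pw := (expgz u).
Local Notation G := (full_group u).

Lemma fullM (g h : G) x : (g * h)%g x = g (h x).
Proof. by []. Qed.

Lemma commuteE (g h : G) x : commute g h -> g (h x) = h (g x).
Proof. by move=> gh; rewrite -fullM gh. Qed.

Lemma full_expS (g : G) n x : (g ^+ n.+1)%g x = g ((g ^+ n)%g x).
Proof. by rewrite expgS. Qed.

Lemma full_expD (g : G) m n x : (g ^+ (m + n))%g x = (g ^+ m)%g ((g ^+ n)%g x).
Proof. by rewrite expgnDr. Qed.

Lemma commute_expgz (g h : G) n : commute g h -> commute g (expgz h n).
Proof.
by move=> gh; case: n => n /=; [|apply: commuteV]; apply: commuteX.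
Qed.

Lemma exp_dvd_fix (g : G) d n x : (d %| n)%N -> (g ^+ d)%g x = x ->
  (g ^+ n)%g x = x.
Proof.
move=> /dvdnP[k ->] gx; elim: k => // k IH.
by rewrite mulSn full_expD IH.
Qed.

Lemma exp_dvd_orbit (g h : G) d n e x : commute g h -> (d %| n)%N ->
  (g ^+ d)%g x = expgz h e x -> exists e', (g ^+ n)%g x = expgz h e' x.
Proof.
move=> gh /dvdnP[k ->] gx; elim: k => [|k [e' IH]]; first by exists 0.
exists (e' + e); rewrite mulSn full_expD IH expgzD fullM -gx.
by apply: commuteE; apply/commute_expgz/commute_sym/commuteX/commute_sym.
Qed.

(** Pigeonhole principle. Two coinciding points among [a ^ i (b ^ j z)] give a
    relation between [a] and [b] at [z], in which either [a] does not occur or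
    its exponent is not zero. *)
Lemma commuting_collision (a b : G) : commute a b -> exists L, forall z,
  (exists2 e, (0 < e <= L)%N & (b ^+ e)%g z = z) \/
  (exists2 d, (0 < d <= L)%N & exists e, (a ^+ d)%g z = expgz b e z).
Proof.
move=> ab; have [Ca HCa] := full_bounded hu a; have [Cb HCb] := full_bounded hu b.
pose C := maxn Ca Cb.
have word (g : G) (i : nat) z : (forall x, exists n, (`|n| <= C)%N /\ g x = pw n x) ->
    exists n, (`|n| <= i * C)%N /\ (g ^+ i)%g z = pw n z.
  move=> gC; elim: i => [|i [n [nC gz]]]; first by exists 0.
  have [m [mC gm]] := gC ((g ^+ i)%g z).
  exists (m + n); rewrite pwD -gz full_expS; split=> //.
  by rewrite mulSn; lia.
have Ha z i : exists n, (`|n| <= i * C)%N /\ (a ^+ i)%g z = pw n z.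
  apply: word => x; have [n [nC ax]] := HCa x; exists n; split=> //.
  exact: leq_trans nC (leq_maxl _ _).
have Hb z i : exists n, (`|n| <= i * C)%N /\ (b ^+ i)%g z = pw n z.
  apply: word => x; have [n [nC bx]] := HCb x; exists n; split=> //.
  exact: leq_trans nC (leq_maxr _ _).
(* The points lie at distance at most [2 K C] from [z], whence at most
   [4 K C + 1] of them, which is less than [K ^ 2]. *)
pose K := (4 * C + 2)%N; exists K => z.
have /choice [n nP] : forall ij : 'I_K * 'I_K, exists n,
    (`|n| <= 2 * (K * C))%N /\ (a ^+ ij.1)%g ((b ^+ ij.2)%g z) = pw n z.
  move=> [i j] /=; have [m [mC bz]] := Hb z j.
  have [m' [mC' az]] := Ha ((b ^+ j)%g z) i.
  exists (m' + m); rewrite pwD -bz -az; split=> //.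
  have : (i * C <= K * C)%N by rewrite leq_mul2r (ltnW (ltn_ord i)) orbT.
  have : (j * C <= K * C)%N by rewrite leq_mul2r (ltnW (ltn_ord j)) orbT.
  lia.
pose f ij : 'I_(4 * (K * C)).+1 := inord (absz (n ij + (2 * (K * C))%N%:Z)).
have [ij [ij' [ijN fE]]] : exists ij ij', ij <> ij' /\ f ij = f ij'.
  apply: contrapT => H.
  have /leq_card : injective f.
    by move=> p q fpq; apply: contrapT => pq; apply: H; exists p, q.
  rewrite card_prod !card_ord /K; nia.
have nE : n ij = n ij'.
  have := congr1 val fE; rewrite /f /= !inordK; have [] := nP ij; have [] := nP ij'; lia.
have {nE fE nP} : (a ^+ ij.1)%g ((b ^+ ij.2)%g z) = (a ^+ ij'.1)%g ((b ^+ ij'.2)%g z).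
  by rewrite (nP ij).2 (nP ij').2 nE.
have {ijN} : (ij.1 : nat, ij.2 : nat) <> (ij'.1 : nat, ij'.2 : nat).
  move=> [/val_inj e1 /val_inj e2]; apply: ijN.
  by rewrite [ij]surjective_pairing e1 e2 -surjective_pairing.
have : (ij.1 < K)%N /\ (ij.2 < K)%N by [].
have : (ij'.1 < K)%N /\ (ij'.2 < K)%N by [].
move: (ij.1 : nat) (ij.2 : nat) (ij'.1 : nat) (ij'.2 : nat) => i j i' j'.
wlog: i j i' j' / (i < i')%N || (i == i') && (j <= j')%N.
  move=> W h' h ne eq.
  have ne' : (i', j') <> (i, j) by move=> [e1 e2]; apply: ne; rewrite e1 e2.
  have [H|H] := boolP ((i < i')%N || (i == i') && (j <= j')%N).
    exact: (W i j i' j').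
  by apply: (W i' j' i j) => //; lia.
case/orP => [ii' [iK' jK'] [iK jK] _|/andP[/eqP <- jj'] [iK jK] [_ jK'] ne].
  rewrite -(subnKC (ltnW ii')) full_expD => /homeo_inj bz.
  right; exists (i' - i)%N; first by lia.
  exists (j%:Z - j'%:Z); rewrite addrC expgzD fullM expgzN.
  rewrite -[expgz b j z]/((b ^+ j)%g z) bz.
  rewrite (commuteE (g := (a ^+ _)%g)); last exact/commuteX/commute_sym/commuteX/commute_sym.
  by rewrite -[RHS]fullM mulVg.
move=> /homeo_inj; rewrite -(subnKC jj') full_expD => /homeo_inj bz.
left; exists (j' - j)%N; last by rewrite -bz.
have : j <> j' by move=> jE; apply: ne; rewrite jE.
lia.
Qed.

End Displacement.

(** * The dichotomy for disjoint clopen sets *)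

(** For [U] the complement of a point, or the whole space, this is the form in
    which stabilizers are described below. *)
Definition germ3_on (X : topologicalType) (u : homeo X)
    (H : set (full_group u)) (U : set X) :=
  forall x i j k, uniq [:: i; j; k] ->
    U (expgz u i x) -> U (expgz u j x) -> U (expgz u k x) -> germ3 H x i j k.

Section GermsOn.
Variables (X : topologicalType) (u : homeo X) (hu : cantor_minimal u).
Local Notation pw := (expgz u).
Local Notation G := (full_group u).
Implicit Types (H : set G) (U : set X).

Lemma cycle3_shift i j k n d : cycle3 (i + d) (j + d) (k + d) (n + d) = cycle3 i j k n + d.
Proof. by rewrite /cycle3 !(inj_eq (addIr d)); do 3?[case: ifP => // _]. Qed.

Lemma germ3_shift H x i j k d :
  germ3 H x (i + d) (j + d) (k + d) -> germ3 H (pw d x) i j k.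
Proof.
move=> [W xW hW]; exists (pw (- d) @^-1` W); first by apply: near_pw; rewrite pwNK.
move=> A AW clA c [cs cx]; apply: (hW (pw d @^-1` A)).
- by move=> y /AW; rewrite /= pwNK.
- exact: clopen_preim.
split=> [a n Aa nt|x' xA].
  rewrite -[n](subrK d) in nt *; move: (n - d) nt => m nt.
  rewrite cycle3_shift !pwD cs //.
  by move: nt; rewrite !inE !(inj_eq (addIr d)).
apply: cx => n nt An; apply: (xA (n + d)); first by move: nt; rewrite !inE !(inj_eq (addIr d)).
by rewrite /= -pwD opprD addrCA addrN addr0.
Qed.

Lemma germ3_sub H H' x i j k : H `<=` H' -> germ3 H x i j k -> germ3 H' x i j k.
Proof. by move=> HH h; apply: small_mono h _ => A h clA c cm; exact/HH/h. Qed.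

(** Freeness: the value at one point determines the local exponent. *)
Lemma full_local (g : G) x i i' : g (pw i x) = pw i' x ->
  \forall y \near x, g (pw i y) = pw i' y.
Proof.
move=> gx; have [n gn] := full_groupP g (pw i x).
have ni : i' = n + i by apply: (pw_inj hu (x := x)); rewrite -gx (nbhs_singleton gn) pwD.
by have := near_pw gn; apply: filterS => y; rewrite ni pwD.
Qed.

(** Conjugation by [g] transports 3-cycles even though [g] may act on the three
    levels by different powers of [u]: over a small base these powers are
    constant. *)
Lemma germ3_conj H (g : G) x i j k i' j' k' : uniq [:: i; j; k] ->
  g (pw i x) = pw i' x -> g (pw j x) = pw j' x -> g (pw k x) = pw k' x ->
  germ3 H x i j k -> germ3 [set c | H (g^-1 * c * g)%g] x i' j' k'.
Proof.
move=> ijk gi gj gk h.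
have uniq' : uniq [:: i'; j'; k'].
  have inj m n m' n' : g (pw m x) = pw m' x -> g (pw n x) = pw n' x -> m <> n -> m' <> n'.
    by move=> gm gn mn mn'; apply: mn; apply: (pw_inj hu (x := x)); apply: (@homeo_inj _ g); rewrite gm gn mn'.
  have := (inj _ _ _ _ gi gj, inj _ _ _ _ gi gk, inj _ _ _ _ gj gk).
  case=> [[hij hik] hjk]; move: ijk; distinct.
  by repeat (apply/andP; split); apply/eqP; auto.
have sm : small x (fun A => forall a, A a -> [/\ g (pw i a) = pw i' a,
    g (pw j a) = pw j' a & g (pw k a) = pw k' a]).
  exists [set a | [/\ g (pw i a) = pw i' a, g (pw j a) = pw j' a & g (pw k a) = pw k' a]].
    have := full_local gi; have := full_local gj; have := full_local gk.
    by apply: filterS3 => a.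
  by move=> A AW a /AW.
apply: small_mono (small_and h sm) _ => A [{}h {}sm] clA c [cs cx] /=.
apply: h => //; split=> [a n Aa nt|y yA].
  have [{}gi {}gj {}gk] := sm a Aa.
  have gV m m' : g (pw m a) = pw m' a -> (g^-1)%g (pw m' a) = pw m a.
    by move=> <-; apply: homeoK.
  have [ti tj tk] : [/\ i' \in [:: i'; j'; k'], j' \in [:: i'; j'; k'] & k' \in [:: i'; j'; k']].
    by rewrite !inE !eqxx !orbT.
  move: nt; rewrite !inE !fullM => /or3P[] /eqP ->.
  - by rewrite gi cs // !cycle3_fst; exact: gV.
  - rewrite gj cs // !cycle3_snd; first exact: gV.
      by move: ijk; clear; distinct; congruence.
    by move: uniq'; clear; distinct; congruence.
  - rewrite gk cs // !cycle3_trd; first exact: gV.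
    1,2: by move: ijk; clear; distinct; congruence.
    1,2: by move: uniq'; clear; distinct; congruence.
rewrite !fullM cx; first exact: homeoK.
move=> n nt An; have [gi' gj' gk'] := sm _ An.
have key m : g (pw m (pw (- n) (g y))) = g y -> A (pw (- m) y).
  move=> /homeo_inj e.
  by have -> : pw (- m) y = pw (- n) (g y) by rewrite -{1}e pwNK.
move: nt gi' gj' gk' key An; rewrite !inE => /or3P[] /eqP ->; rewrite ?pwKN.
- by move=> gm _ _ key An; apply: (yA i); [rewrite !inE eqxx|exact: key].
- by move=> _ gm _ key An; apply: (yA j); [rewrite !inE eqxx ?orbT|exact: key].
- by move=> _ _ gm key An; apply: (yA k); [rewrite !inE eqxx ?orbT|exact: key].
Qed.

Lemma germ3_on_conj H (g : G) U : germ3_on H (g @^-1` U) ->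
  germ3_on [set c | H (g^-1 * c * g)%g] U.
Proof.
move=> h x i' j' k' ijk' Ui Uj Uk.
have pre m' : exists m, g (pw m x) = pw m' x.
  have [n gn] := full_groupE (g^-1)%g (pw m' x).
  by exists (n + m'); rewrite pwD -gn; exact: homeoVK.
have [[i gi] [j gj] [k gk]] := And3 (pre i') (pre j') (pre k').
have ijk : uniq [:: i; j; k].
  have ne m n m' n' : g (pw m x) = pw m' x -> g (pw n x) = pw n' x -> m' <> n' -> m <> n.
    by move=> gm gn mn' mn; apply: mn'; apply: (pw_inj hu (x := x)); rewrite /= -gm -gn mn.
  have := (ne _ _ _ _ gi gj, ne _ _ _ _ gi gk, ne _ _ _ _ gj gk).
  case=> [[hij hik] hjk]; move: ijk'; distinct.
  by repeat (apply/andP; split); apply/eqP; auto.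
by apply: (germ3_conj ijk gi gj gk); apply: h; rewrite //= (gi, gj, gk).
Qed.

Lemma germ3_on_glue H (c : G) i j k A : subgroup H -> germ3_on H setT ->
  uniq [:: i; j; k] -> clopen A -> tower u [:: i; j; k] A ->
  moves_tower u [:: i; j; k] (cycle3 i j k) A c -> H c.
Proof.
by move=> sH hH ijk clA tA; apply: germ3_glue => // x _; exact: hH.
Qed.

Lemma fresh_index U x (s : seq int) : clopen U -> U !=set0 ->
  exists n, U (pw n x) /\ n \notin s.
Proof.
move=> [oU _] U0; have [n [Un ns]] := fresh hu oU U0 x [seq pw m x | m <- s].
by exists n; split=> //; apply: contra ns => ns; apply/mapP; exists n.
Qed.

End GermsOn.

Section Dichotomy.
Variables (X1 X2 : topologicalType) (u1 : homeo X1) (u2 : homeo X2).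
Hypotheses (hu1 : cantor_minimal u1) (hu2 : cantor_minimal u2).
Local Notation pw := (expgz u1).
Local Notation G := (full_group u1).
Variable rho : {multiplicative G -> full_group u2}.

Definition stab (y : X2) : set G := [set g | rho g y = y].

Lemma rhoM (g h : G) y : rho (g * h)%g y = rho g (rho h y).
Proof. by rewrite gmulfM. Qed.

Lemma rho_one : rho 1%g = 1%g.
Proof. by apply: (mulIg (rho 1%g)); rewrite -gmulfM !mul1g. Qed.

Lemma rho1 y : rho 1%g y = y.
Proof. by rewrite rho_one. Qed.

Lemma rhoVK (g : G) y : rho (g^-1)%g (rho g y) = y.
Proof. by rewrite -rhoM mulVg rho1. Qed.

Lemma rhoKV (g : G) y : rho g (rho (g^-1)%g y) = y.
Proof. by rewrite -rhoM mulgV rho1. Qed.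

Lemma subgroup_stab y : subgroup (stab y).
Proof.
split=> [|g h|g]; rewrite /stab /= ?rho1 ?rhoM //.
  by move=> gy ->.
by move=> {1}<-; rewrite rhoVK.
Qed.

Lemma rhoX (g : G) n : (rho (g ^+ n) = rho g ^+ n)%g.
Proof. by elim: n => [|n IH]; rewrite ?expg0 ?rho_one // !expgS gmulfM IH. Qed.

Lemma rho_commute (g h : G) : commute g h -> commute (rho g) (rho h).
Proof. by rewrite /commute -!gmulfM => ->. Qed.

(** Two disjoint clopen sets cannot both carry a part of the action at [y]. The
    set [V] wins if all conjugates of [b ^ M] fix [y]. Otherwise the [b]-orbit of
    some translate [z] of [y] has length greater than [L], hence so does the
    [b]-orbit of every [rho g z] with [g] supported in [U], as [g] and [b]
    commute; the collision principle then gives [a ^ M (rho g z)] as a point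
    of the [b]-orbit of [rho g z]. *)
Lemma germ3_on_dichotomy U V y : clopen U -> clopen V -> U `&` V = set0 ->
  germ3_on (stab y) U \/ germ3_on (stab y) V.
Proof.
move=> clU clV UV.
have [a [aU a_free]] := return_map hu1 clU.
have [b [bV b_free]] := return_map hu1 clV.
have disj (g h : G) : supported U g -> supported V h -> commute g h.
  move=> gU hV; apply: commute_disjoint => x.
  have [Ux|Ux] := pselect (U x); [right; apply: hV => Vx|by left; exact: gU].
  by have : (U `&` V) x by []; rewrite UV.
have [L HL] := commuting_collision hu2 (rho_commute (disj _ _ aU bV)).
pose M := L`!.
have MS : M = M.-1.+1 by rewrite prednK // fact_gt0.
have dvdM d : (0 < d <= L)%N -> (d %| M)%N by move=> dL; exact: dvdn_fact.
have long z : (forall e, (0 < e <= L)%N -> (rho b ^+ e)%g z <> z) ->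
    germ3_on (stab z) U.
  move=> bz.
  pose H : set G := [set h | commute h b /\ exists e, rho h z = expgz (rho b) e z].
  have sH : subgroup H.
    split=> [|g h [gb [e ge]] [hb [f hf]]|g [gb [e ge]]].
    - by split; [exact/commute_sym/commute1|exists 0; rewrite rho1].
    - split; first exact/commute_sym/commuteM/commute_sym/hb/commute_sym.
      exists (f + e); rewrite rhoM hf expgzD fullM -ge.
      by apply: commuteE; apply/commute_expgz/rho_commute.
    - split; first exact/commute_sym/commuteV/commute_sym.
      exists (- e); apply: (@homeo_inj _ (rho g)); rewrite rhoKV.
      rewrite (commuteE (g := rho g)); last exact/commute_expgz/rho_commute.
      by rewrite ge -fullM -expgzD addNr.
  have cH g : supported U g -> H (g * (a ^+ M) * g^-1)%g.
    move=> gU; have gb := disj _ _ gU bV; have ab := disj _ _ aU bV; split.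
      apply/commute_sym/commuteM; last exact/commuteV/commute_sym.
      by apply: commuteM; [|apply: commuteX]; exact: commute_sym.
    have cgb := commute_sym (rho_commute gb).
    have [[e eL be]|[d dL [e ae]]] := HL (rho (g^-1)%g z).
      case: (bz _ eL); apply: (@homeo_inj _ (rho (g^-1)%g)).
      rewrite -[RHS]be; apply: commuteE; apply: commuteX.
      by apply: rho_commute; exact/commute_sym/commuteV/commute_sym.
    have [e' ae'] := exp_dvd_orbit (rho_commute ab) (dvdM _ dL) ae.
    exists e'; rewrite !rhoM rhoX ae'.
    rewrite (commuteE (g := rho g)); last exact/commute_expgz/commute_sym.
    by rewrite rhoKV.
  have Hn : germ3_on H U.
    move=> x i j k; apply: (germ3_normal hu1 sH clU cH) => x' Ux'.
    by rewrite MS; exact: a_free.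
  move=> x i j k ijk Ui Uj Uk.
  have U0 : U !=set0 by exists (pw i x).
  have [m [Um mijk]] := fresh_index hu1 x [:: i; j; k] clU U0.
  have [n [Un nijk]] := fresh_index hu1 x [:: m; i; j; k] clU U0.
  have u5 : uniq [:: i; m; k; j; n].
    move: ijk mijk nijk; rewrite !inE !negb_or; distinct.
    move=> /and3P[/eqP ? /eqP ? /eqP ?] /and4P[/eqP ? /eqP ? /eqP ? /eqP ?].
    by repeat (apply/andP; split); apply/eqP; congruence.
  apply: (germ3_comm hu1 (H := H) u5).
  - move=> g h /(subgroupV sH) [gb [e ge]] /(subgroupV sH) [hb [f hf]].
    (* [H] acts on the [b]-orbit of [z] by translations, which commute. *)
    have swap : rho (g^-1 * h^-1)%g z = rho (h^-1 * g^-1)%g z.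
      rewrite !rhoM ge hf.
      rewrite (commuteE (g := rho (g^-1)%g)); last exact/commute_expgz/rho_commute.
      rewrite (commuteE (g := rho (h^-1)%g)); last exact/commute_expgz/rho_commute.
      by rewrite ge hf -!fullM -!expgzD addrC.
    rewrite /stab /=.
    have -> : (g * h * g^-1 * h^-1 = (h^-1 * g^-1)^-1 * (g^-1 * h^-1))%g.
      by rewrite invgM !invgK !mulgA.
    by rewrite rhoM swap rhoVK.
  - by apply: Hn => //; uniq_from u5.
  - by apply: Hn => //; uniq_from u5.
have [[g [gV gz]]|no] := pselect (exists g, supported V g /\
    forall e, (0 < e <= L)%N -> (rho b ^+ e)%g (rho g y) <> rho g y).
  left=> x i j k ijk Ui Uj Uk.
  (* [g] commutes with the 3-cycles in [U], so they fix [y] if they fix its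
     translate by [g]. *)
  have h := long _ gz x i j k ijk Ui Uj Uk.
  have sm : small x (fun A => forall n, n \in [:: i; j; k] ->
      forall y, A y -> U (pw n y)).
    by apply: small_within clU _ => n; rewrite !inE => /or3P[] /eqP->.
  apply: small_mono (small_and h sm) _ => A [{}h {}sm] clA c cm.
  have cU : supported U c by apply: moves_tower_supported cm => w n Aw nt; exact: sm.
  have cg := rho_commute (disj _ _ cU gV).
  have := h clA c cm; rewrite /stab /= (commuteE y cg).
  exact: homeo_inj.
right=> x i j k ijk; apply: (@germ3_normal _ _ hu1 _ (subgroup_stab y) _ clV (b ^+ M)%g) => //.
  move=> g gV; have [e eL be] : exists2 e, (0 < e <= L)%N &
      (rho b ^+ e)%g (rho (g^-1)%g y) = rho (g^-1)%g y.
    apply: contrapT => H; apply: no; exists (g^-1)%g; split; first exact: supportedV.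
    by move=> e eL be; apply: H; exists e.
  by rewrite /stab /= !rhoM rhoX (exp_dvd_fix (dvdM _ eL) be) rhoKV.
by move=> x' Vx'; rewrite MS; exact: b_free.
Qed.

End Dichotomy.

(** * All 3-cycles away from one point *)

Section OnePoint.
Variables (X : topologicalType) (u : homeo X) (hu : cantor_minimal u).
Local Notation pw := (expgz u).
Local Notation G := (full_group u).
Variables (H : set G) (sH : subgroup H).

Lemma clopen_separating (s t : seq X) : (forall x, x \in s -> x \notin t) ->
  exists U, [/\ clopen U, forall x, x \in s -> U x & forall x, x \in t -> ~ U x].
Proof.
elim: s => [|x s IH] st; first by exists set0; split=> // [|? ? []]; exact: clopen0.
have [y ys|U [clU sU tU]] := IH; first by apply: st; rewrite inE ys orbT.
have : nbhs x (~` [set` t]).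
  apply: open_nbhs_nbhs; split; last by apply/negP/st; rewrite mem_head.
  apply: closed_openC; apply: (accessible_finite_set_closed.1 _ _ (finite_seq t)).
  exact: hausdorff_accessible (cantor_hausdorff hu.1).
case/(clopen_nbhs hu.1) => A [clA Ax At].
exists (A `|` U); split; first exact: clopenU.
  by move=> y; rewrite inE => /predU1P[->|/sU]; [left|right].
by move=> y yt [/At|]; [exact|exact: tU].
Qed.

Lemma germ3_on_sub (K : set G) U V : V `<=` U -> germ3_on K U -> germ3_on K V.
Proof. by move=> VU h x i j k ijk Vi Vj Vk; apply: h => //; exact: VU. Qed.

Lemma fresh_int (s : seq int) : exists n, n \notin s.
Proof.
suff [K HK] : exists K, forall n, K < n -> n \notin s.
  by exists (K + 1); apply: HK; lia.
elim: s => [|m s [K HK]]; first by exists 0.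
exists (Num.max m K) => n; rewrite gt_max inE negb_or => /andP[mn Kn].
by rewrite HK // andbT; apply/eqP => nm; rewrite nm ltxx in mn.
Qed.

Lemma fresh_int2 (s : seq int) : exists m n, [/\ m \notin s, n \notin s & m != n].
Proof.
have [m ms] := fresh_int s; have [n] := fresh_int (m :: s).
by rewrite inE negb_or eq_sym => /andP[mn ns]; exists m, n.
Qed.

Hypothesis dich : forall U V, clopen U -> clopen V -> U `&` V = set0 ->
  germ3_on H U \/ germ3_on H V.

(** Pointwise form of the dichotomy. *)
Let disjoint_triples x a b c z i j k : uniq [:: a; b; c] -> uniq [:: i; j; k] ->
  (forall m n, m \in [:: a; b; c] -> n \in [:: i; j; k] -> pw m x <> pw n z) ->
  germ3 H x a b c \/ germ3 H z i j k.
Proof.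
move=> abc ijk dis.
have [y|U [clU sU tU]] := @clopen_separating
    [seq pw m x | m <- [:: a; b; c]] [seq pw n z | n <- [:: i; j; k]].
  move=> /mapP[m ms ->]; apply/negP => /mapP[n ns]; exact: dis.
have clV : clopen (~` U) by apply: clopen_setC.
have [h|h] := dich clU clV (setICr U); [left|right]; apply: h => //=.
- by apply: sU; rewrite !inE eqxx.
- by apply: sU; rewrite !inE eqxx orbT.
- by apply: sU; rewrite !inE eqxx !orbT.
- by apply: tU; rewrite !inE eqxx.
- by apply: tU; rewrite !inE eqxx orbT.
- by apply: tU; rewrite !inE eqxx !orbT.
Qed.

(** Suppose that the triple [t] of points of the orbit of [x] fails. By the
    dichotomy all triples disjoint from [t] succeed. Call a point of [t] good if
    it forms successful triples with all pairs of points outside [t]. By the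
    dichotomy again, at least one of any two points of [t] is good. Not all
    three are, since otherwise [t] would succeed ([of_good]); and the triples
    that avoid the one that is not good succeed ([core]). The point [x1] is
    the answer if no triple fails. *)
Lemma germ3_off_point (x1 : X) : exists x, germ3_on H (~` [set x]).
Proof.
have [all|] := pselect (germ3_on H setT).
  by exists x1; exact: germ3_on_sub all.
move=> /existsNP[x /existsNP[a /existsNP[b /existsNP[c nall]]]].
have [abc nh] : uniq [:: a; b; c] /\ ~ germ3 H x a b c.
  by split; apply: contrapT => h; apply: nall => // ? _ _ _; apply: contrapT => ?; exact: h.
have [t tE] : exists t, t = [:: a; b; c] by exists [:: a; b; c].
have out z i j k : uniq [:: i; j; k] ->
    (forall m n, m \in t -> n \in [:: i; j; k] -> pw m x <> pw n z) -> germ3 H z i j k.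
  by rewrite tE => ijk dis; case: (disjoint_triples abc ijk dis).
have outx i j k : uniq [:: i; j; k] -> i \notin t -> j \notin t -> k \notin t ->
    germ3 H x i j k.
  move=> ijk it jt kt; apply: out => // m n mt nijk /(pw_inj hu) mn.
  by move: nijk; rewrite !inE => /or3P[] /eqP nE; move: mt; rewrite mn nE; exact/negP.
pose good n := forall p q, p \notin t -> q \notin t -> p != q -> germ3 H x n p q.
have goodP m n : m \in t -> n \in t -> m != n -> good m \/ good n.
  move=> mt nt mn; have [gm|ngood] := pselect (good m); [by left|right].
  have [p [q [pt qt pq ngm]]] : exists p q,
      [/\ p \notin t, q \notin t, p != q & ~ germ3 H x m p q].
    apply: contrapT => h; apply: ngood => p q pt qt pq; apply: contrapT => ngm.
    by apply: h; exists p, q.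
  move=> p' q' pt' qt' pq'.
  have [r [s [rl sl rs]]] := fresh_int2 (p :: q :: p' :: q' :: t).
  have neq l l' : l \in t -> l' \notin t -> l != l'.
    by move=> lt; apply: contra => /eqP <-.
  move: rl sl; rewrite !(in_cons p) !(in_cons q) !(in_cons p') !(in_cons q') !negb_or.
  move=> /and5P[rp rq rp' rq' rt] /and5P[sp sq sp' sq' st].
  have nrs : germ3 H x n r s.
    case: (@disjoint_triples x m p q x n r s) => //.
    - by rewrite /= !inE !negb_or (neq _ _ mt pt) (neq _ _ mt qt) pq.
    - by rewrite /= !inE !negb_or (neq _ _ nt rt) (neq _ _ nt st) rs.
    - move=> l l' + + /(pw_inj hu) ll'; rewrite !inE -ll'.
      have /eqP mr := neq _ _ mt rt; have /eqP ms := neq _ _ mt st.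
      have /eqP np := neq _ _ nt pt; have /eqP nq := neq _ _ nt qt.
      move/eqP: mn rp rq sp sq => mn /eqP rp /eqP rq /eqP sp /eqP sq.
      by case/or3P => /eqP lE; case/or3P => /eqP lE'; congruence.
  have p'rs : germ3 H x p' r s.
    by apply: outx => //; rewrite /= !inE !negb_or rs eq_sym rp' eq_sym sp'.
  have q'rs : germ3 H x q' r s.
    by apply: outx => //; rewrite /= !inE !negb_or rs eq_sym rq' eq_sym sq'.
  apply: (germ3_of_pair hu sH _ nrs p'rs q'rs).
  rewrite /= !inE !negb_or !(neq _ _ nt) // pq' rs.
  by rewrite eq_sym rp' eq_sym sp' eq_sym rq' eq_sym sq'.
have of_good i j k : uniq [:: i; j; k] ->
    (forall n, n \in [:: i; j; k] -> n \in t -> good n) -> germ3 H x i j k.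
  move=> ijk gt.
  have [r [s [rl sl rs]]] := fresh_int2 (i :: j :: k :: t).
  move: rl sl; rewrite !(in_cons i) !(in_cons j) !(in_cons k) !negb_or.
  move=> /and4P[ri rj rk rt] /and4P[si sj sk st].
  have u5 : uniq [:: i; j; k; r; s].
    move: ijk; rewrite /= !inE !negb_or rs ![_ == r]eq_sym ![_ == s]eq_sym.
    by rewrite ri rj rk si sj sk => /and3P[/andP[-> ->] -> _].
  have nrs n : n \in [:: i; j; k] -> germ3 H x n r s.
    move=> nijk; have [nt|nt] := boolP (n \in t).
      by apply: (gt n nijk nt).
    apply: outx => //; move: nijk.
    rewrite /= !inE !negb_or rs ![_ == r]eq_sym ![_ == s]eq_sym.
    by case/or3P => /eqP ->; rewrite ?ri ?rj ?rk ?si ?sj ?sk.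
  by apply: (germ3_of_pair hu sH u5); apply: nrs; rewrite !inE eqxx ?orbT.
have core n : n \in t -> (forall m, m \in t -> m != n -> good m) ->
    germ3_on H (~` [set pw n x]).
  move=> nt gt z i j k ijk zi zj zk.
  have [dis|] := pselect (forall m l, m \in t -> l \in [:: i; j; k] -> pw m x <> pw l z).
    exact: out.
  move=> /existsNP[m /existsNP[l /not_implyP[mt /not_implyP[lt /contrapT ml]]]].
  have zE : z = pw (m - l) x.
    by rewrite addrC pwD ml pwNK.
  rewrite zE in zi zj zk *; apply: germ3_shift.
  move: (m - l) zi zj zk => d; rewrite /setC /= -!pwD => zi zj zk.
  apply: of_good; first by move: ijk; rewrite /= !inE !(inj_eq (addIr d)).
  move=> o ol ot; apply: gt => //; apply/eqP => on; move: ol; rewrite !inE on.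
  by case/or3P => /eqP nE; [apply: zi|apply: zj|apply: zk]; rewrite -nE.
have [ab ac bc] : [/\ a != b, a != c & b != c].
  by move: abc; rewrite /= !inE !negb_or => /and3P[/andP[]].
have [ta tb tc] : [/\ a \in t, b \in t & c \in t] by rewrite tE !inE !eqxx !orbT.
have inT (P : int -> Prop) : P a -> P b -> P c -> forall m, m \in t -> P m.
  by move=> Pa Pb Pc m; rewrite tE !inE => /or3P[] /eqP->.
have [ga|ga] := pselect (good a); last first.
  exists (pw a x); apply: core => //; apply: inT => [|_|_]; first by rewrite eqxx.
    by case: (goodP a b).
  by case: (goodP a c).
have [gb|gb] := pselect (good b); last first.
  exists (pw b x); apply: core => //; apply: inT => [_||_] //; first by rewrite eqxx.
  by case: (goodP b c).
exists (pw c x); apply: core => //; apply: inT => [_|_|] //; by rewrite eqxx.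
Qed.

(** Every point of an orbit is different from [x] or from [y], and thus forms a
    3-cycle in [H] with two fixed points that differ from both. *)
Lemma germ3_on_two_points x y : x <> y ->
  germ3_on H (~` [set x]) -> germ3_on H (~` [set y]) -> germ3_on H setT.
Proof.
move=> xy hx hy z i j k ijk _ _ _.
have clT : clopen [set: X] by exact: clopenT.
have T0 : [set: X] !=set0 by exists x.
have [r [_ rl]] := fresh hu clT.1 T0 z [:: x; y; pw i z; pw j z; pw k z].
have [s [_ sl]] := fresh hu clT.1 T0 z [:: pw r z; x; y; pw i z; pw j z; pw k z].
have ne m n : pw m z != pw n z -> m != n by apply: contra => /eqP->.
move: rl sl; rewrite !in_cons !negb_or.
move=> /and5P[rx ry /ne ri /ne rj /andP[/ne rk _]] /and5P[/ne sr sx sy /ne si /and3P[/ne sj /ne sk _]].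
have u5 : uniq [:: i; j; k; r; s].
  move: ijk; rewrite /= !inE !negb_or ![_ == r]eq_sym ![_ == s]eq_sym.
  by rewrite ri rj rk si sj sk sr => /and3P[/andP[-> ->] -> _].
have step n : n != r -> n != s -> germ3 H z n r s.
  move=> nr ns.
  have u3 : uniq [:: n; r; s] by rewrite /= !inE !negb_or nr ns eq_sym sr.
  have [nx|nx] := eqVneq (pw n z) x.
    by apply: hy => //=; [rewrite nx|exact/eqP|exact/eqP].
  by apply: hx => //=; exact/eqP.
by apply: (germ3_of_pair hu sH u5); apply: step; rewrite eq_sym.
Qed.

End OnePoint.

(** * Supports and factor maps *)

Section FixedPoints.
Variables (X : topologicalType) (u : homeo X) (hu : cantor_minimal u).
Local Notation G := (full_group u).

(** By freeness, the local exponent at a fixed point is zero, so fixing a point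
    is fixing a neighbourhood of it. *)
Lemma fixed_clopen (g : G) : clopen [set y | g y = y].
Proof.
split.
  rewrite openE => y /= gy; have [n gn] := full_groupP g y.
  have n0 : n = 0 by apply: (pw_free hu (x := y)); rewrite -(nbhs_singleton gn).
  by apply: filterS gn => z gz; rewrite /= gz n0.
rewrite -[X in closed X]setCK; apply: open_closedC.
rewrite openE => y /= gy.
have [W yW hW] := small_sep hu.1 (f := val g) (g := 1%g) gy.
apply: filterS yW => z Wz gz.
by apply: (hW [set z]) gz => //= w ->.
Qed.


Definition moved (g : homeo X) : set X := [set y | g y <> y].

Lemma moved_clopen (g : G) : clopen (moved g).
Proof. exact/clopen_setC/fixed_clopen. Qed.

Lemma SuppE (g : G) : Supp g = moved g.
Proof. by rewrite /Supp -(closure_id _).1 //; case: (moved_clopen g). Qed.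

Lemma moved_stable (g : G) y : moved g y -> moved g (g y).
Proof. by move=> gy /homeo_inj. Qed.

(** Total maps are easier to handle than maps on the subtype [Supp v]; since the
    support is open, continuity at its points can be tested in [X]. *)
Lemma factors_ontoP (v : G) (Z : topologicalType) (z0 : Z) (w : homeo Z) :
  factors_onto (Supp_map v) w <->
  exists q : X -> Z, [/\ forall y, moved v y -> {for y, continuous q},
    forall y, moved v y -> w (q y) = q (v y) &
    forall z, exists2 y, moved v y & q y = z].
Proof.
have inP y : moved v y -> y \in Supp v by rewrite SuppE; exact: mem_set.
have oS : open (Supp v) by rewrite SuppE; case: (moved_clopen v).
split=> [[q [cq sq wq]]|[q [cq wq sq]]].
  exists (valL_ z0 q).
  have qE (y : X) (Sy : y \in Supp v) : valL_ z0 q y = q (exist _ y Sy).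
    exact: (congr1 (fun f => f (exist _ y Sy)) (@valLK _ _ z0 (Supp v) q)).
  split=> [y vy|y vy|z].
  - have := (subspace_valL_continuousP' (Supp v) z0 q).2 cq.
    rewrite continuous_open_subspace //; apply; exact: inP.
  - rewrite (qE _ (inP _ vy)) (qE _ (inP _ (moved_stable vy))).
    rewrite -[LHS]/((w \o q) _) wq /=.
    by congr q; apply: val_inj.
  - have [[y Sy] _ <-] := sq z I; exists y; last exact: qE.
    by have := set_mem Sy; rewrite SuppE.
exists (q \o set_val); split=> [|z _|s].
- apply/(subspace_sigL_continuousP (Supp v) q).1.
  rewrite continuous_open_subspace // => y /set_mem.
  by rewrite SuppE; exact: cq.
- have [y vy <-] := sq z; exists (exist _ y (inP _ vy)) => //.
- have vs : moved v (set_val s) by rewrite -SuppE; exact: set_valP.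
  exact: wq vs.
Qed.

End FixedPoints.

(** * From factor maps to embeddings *)

Section EmbeddingOfFactor.
Variables (X Y : topologicalType) (u : homeo X) (w : homeo Y).
Hypotheses (hu : cantor_minimal u) (hw : cantor_minimal w).
Variables (v : full_group w) (q : Y -> X).
Hypothesis q_cont : forall y, moved v y -> {for y, continuous q}.
Hypothesis q_equiv : forall y, moved v y -> u (q y) = q (v y).
Hypothesis q_surj : forall x, exists2 y, moved v y & q y = x.

Let cocycle (g : full_group u) (x : X) : int := projT1 (cid (full_groupE g x)).

Let cocycleE (g : full_group u) x : g x = expgz u (cocycle g x) x.
Proof. by rewrite /cocycle; case: cid. Qed.

Let cocycle_uniq (g : full_group u) x n : g x = expgz u n x -> cocycle g x = n.
Proof. by rewrite cocycleE => /(pw_inj hu). Qed.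

Let vpow_equiv n y : moved v y ->
  moved v (expgz v n y) /\ q (expgz v n y) = expgz u n (q y).
Proof.
have vVK z : v ((v^-1)%g z) = z by exact: homeoVK.
have vV z : moved v z -> moved v ((v^-1)%g z) /\ q ((v^-1)%g z) = (u^-1)%g (q z).
  move=> vz; have vz' : moved v ((v^-1)%g z).
    by rewrite /moved /= vVK => h; apply: vz; rewrite {1}h vVK.
  by split=> //; apply: (@homeo_inj _ u); rewrite (q_equiv vz') homeoVK vVK.
elim/int_rect: n y => [|n IH|n IH] y vy; first by [].
- rewrite -addn1 PoszD addrC !pwD !expgzD.
  have [vn qn] := IH y vy.
  have := moved_stable vn; have := q_equiv vn; rewrite qn => <- ?.
  by split; rewrite //= ?expg1.
- have -> : (- n.+1%:Z) = - 1 + - n%:Z by rewrite -addn1 PoszD opprD addrC.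
  rewrite pwD expgzD; have [vn qn] := IH y vy.
  by have [? ?] := vV _ vn; split; rewrite // -qn.
Qed.

Let phi (g : full_group u) (y : Y) : Y :=
  if `[< moved v y >] then expgz v (cocycle g (q y)) y else y.

Let phi_in (g : full_group u) y : moved v y -> phi g y = expgz v (cocycle g (q y)) y.
Proof. by rewrite /phi => /asboolP->. Qed.

Let phi_out (g : full_group u) y : ~ moved v y -> phi g y = y.
Proof. by rewrite /phi => /asboolPn/negPf->. Qed.

Let phiM (g h : full_group u) y : phi (g * h)%g y = phi g (phi h y).
Proof.
have [vy|vy] := pselect (moved v y); last by rewrite !phi_out.
have [vn qn] := vpow_equiv (cocycle h (q y)) vy.
rewrite (phi_in h vy) !phi_in // qn -[RHS]fullM -expgzD.
rewrite (cocycle_uniq (g := (g * h)%g) (n := cocycle g (h (q y)) + cocycle h (q y))).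
  by rewrite [h _]cocycleE.
by rewrite pwD -!cocycleE.
Qed.

Let phi1 y : phi 1%g y = y.
Proof.
have [vy|vy] := pselect (moved v y); last by rewrite !phi_out.
by rewrite phi_in // (cocycle_uniq (n := 0)).
Qed.

Let phi_full (g : full_group u) : exists f : full_group w, f =1 phi g.
Proof.
apply: (@full_of_fun _ _ _ (phi (g^-1)%g)) => y.
- by rewrite -phiM mulVg phi1.
- by rewrite -phiM mulgV phi1.
- have clv := moved_clopen hw v.
  have [vy|vy] := pselect (moved v y); last first.
    exists 0; have : \forall z \near y, (~` moved v) z.
      by apply: near_clopen => //; apply: clopen_setC.
    by apply: filterS => z; exact: phi_out.
  have [n gn] := full_groupP g (q y).
  have [m vm] := full_groupP (expgz v n) y; exists m.
  have n1 := near_clopen clv vy.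
  have n2 : \forall z \near y, g (q z) = expgz u n (q z) by exact: (q_cont vy gn).
  by apply: filterS3 n1 n2 vm => z vz gz <-; rewrite phi_in // (cocycle_uniq gz).
Qed.

Lemma embedding_of_factor : group_embeds (full_group u) (full_group w).
Proof.
have /choice [f fE] := phi_full.
have fM : {morph f : g h / (g * h)%g}.
  by move=> g h; apply: eq_full => y; rewrite fE phiM -!fE.
pose F : {multiplicative full_group u -> full_group w} :=
  HB.pack f (isMultiplicative.Build _ _ f fM).
exists F => g h /= gh; apply: eq_full => x.
have [y vy <-] := q_surj x.
have /(congr1 q) : phi g y = phi h y by rewrite -!fE gh.
by rewrite !phi_in // (vpow_equiv _ vy).2 (vpow_equiv _ vy).2 -!cocycleE.
Qed.

End EmbeddingOfFactor.

(** * From embeddings to factor maps *)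

Section FactorOfEmbedding.
Variables (X1 X2 : topologicalType) (u1 : homeo X1) (u2 : homeo X2).
Hypotheses (hu1 : cantor_minimal u1) (hu2 : cantor_minimal u2).
Local Notation pw := (expgz u1).
Local Notation G := (full_group u1).
Variables (rho : {multiplicative G -> full_group u2}) (x1 : X1).
Hypothesis rho_inj : injective rho.

Local Notation St := (stab rho).

Let Y : set X2 := [set y | ~ germ3_on (St y) setT].

Let q (y : X2) : X1 := projT1 (cid (germ3_off_point hu1 (subgroup_stab rho y)
  (fun U V cU cV => germ3_on_dichotomy hu1 hu2 rho y cU cV) x1)).

Let q_off y : germ3_on (St y) (~` [set q y]).
Proof. by rewrite /q; case: cid. Qed.

Let q_uniq y x : Y y -> germ3_on (St y) (~` [set x]) -> q y = x.
Proof.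
move=> Yy hx; apply: contrapT => qx; apply: Yy.
exact: (germ3_on_two_points hu1 (subgroup_stab rho y) qx (q_off (y := y)) hx).
Qed.

Let germ3_on_move y (g : G) U : germ3_on (St y) (g @^-1` U) ->
  germ3_on (St (rho g y)) U.
Proof.
move=> /(germ3_on_conj hu1) h x i j k ijk Ui Uj Uk.
apply: germ3_sub (h x i j k ijk Ui Uj Uk) => c; rewrite /stab /= !rhoM.
by move=> /(congr1 (rho g)); rewrite rhoKV.
Qed.

Let Y_stable (g : G) y : Y y -> Y (rho g y).
Proof.
move=> Yy h; apply: Yy; rewrite -(rhoVK rho g y).
exact: germ3_on_move.
Qed.

Let q_equiv (g : G) y : Y y -> q (rho g y) = g (q y).
Proof.
move=> Yy; apply: q_uniq; first exact: Y_stable.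
apply: germ3_on_move; apply: germ3_on_sub (q_off (y := y)) => x gx /= xq.
by apply: gx; rewrite xq.
Qed.

(** Once [q] is known to be equivariant, a stabilizer tells where [q y] may lie:
    only among the common fixed points of its elements. *)
Let stab_fixes_q (c : G) y : Y y -> St y c -> c (q y) = q y.
Proof. by move=> Yy cy; rewrite -(q_equiv c Yy) cy. Qed.

Let stab_moves x y U : germ3_on (St y) U -> open U -> U x ->
  exists2 c, St y c & c x <> x.
Proof.
move=> h oU Ux; have U0 : U !=set0 by exists x.
have [m [Um mx]] := fresh hu1 oU U0 x [:: x].
have [n [Un nx]] := fresh hu1 oU U0 x [:: x; pw m x].
have ne i j : pw i x != pw j x -> i != j by apply: contra => /eqP->.
have u3 : uniq [:: 0; m; n].
  have ne0 i : pw i x != x -> i != 0 by apply: contra => /eqP->.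
  move: mx nx; rewrite !in_cons !negb_or => /andP[mx _] /and3P[nx nmx _].
  have [m0 n0 nm] := And3 (ne0 _ mx) (ne0 _ nx) (ne _ _ nmx).
  by rewrite /= !inE !negb_or ![_ == m]eq_sym ![_ == n]eq_sym m0 n0 nm.
have [A [clA Ax hA]] := small_clopen hu1.1
  (small_and (h x 0 m n u3 Ux Um Un) (small_tower hu1 [:: 0; m; n] x)).
have [hc tA] := hA A (@subset_refl _ A).
have [c cm] : exists c : G, moves_tower u1 [:: 0; m; n] (cycle3 0 m n) A c.
  by apply: cycle3_exists => //; rewrite !inE eqxx ?orbT.
exists c; first exact: hc.
rewrite -[X in c X](pw0 u1) cm.1 ?mem_head // cycle3_fst.
by move: mx; rewrite inE => /eqP.
Qed.

(** Membership in a stabilizer is an open condition on the point, so by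
    compactness finitely many elements of [stab y] that move all points of [C]
    stay in the stabilizers of the points near [y]. This gives both that [Y] is
    closed and that [q] is continuous. *)
Let stab_moves_near y (C : set X1) : closed C ->
  (forall x, C x -> exists2 c, St y c & c x <> x) ->
  \forall z \near y, forall x, C x -> exists2 c, St z c & c x <> x.
Proof.
move=> cC hC.
have compC : compact C by apply: (subclosed_compact cC (cantor_compact hu1.1)).
apply: ((compact_near_coveringP C).1 compC X2 (nbhs y)
  (fun z x => exists2 c, St z c & c x <> x) _) => x Cx.
have [c cy cx] := hC x Cx.
exists (moved c, St ^~ c); last by move=> [x' z] /= [cx' cz]; exists c.
split; first exact: near_clopen (moved_clopen hu1 c) cx.
exact: near_clopen (fixed_clopen hu2 (rho c)) cy.
Qed.

(** [Y] is open since a 3-cycle that is not in [stab y] is not in the stabilizers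
    of nearby points [z], and by gluing it would be if [z] were not in [Y]. *)
Let Y_clopen : clopen Y.
Proof.
split.
  rewrite openE => y /= Yy.
  have [x [i [j [k [ijk nh]]]]] : exists x i j k,
      uniq [:: i; j; k] /\ ~ germ3 (St y) x i j k.
    apply: contrapT => H; apply: Yy => x i j k ijk _ _ _.
    by apply: contrapT => nh; apply: H; exists x, i, j, k.
  have [A [clA Ax tA]] := small_clopen hu1.1 (small_tower hu1 [:: i; j; k] x).
  have [B [BA [clB [c [cm ncy]]]]] : exists B, B `<=` A /\ clopen B /\
      exists c : G, moves_tower u1 [:: i; j; k] (cycle3 i j k) B c /\ ~ St y c.
    apply: contrapT => H; apply: nh; exists A; first exact: near_clopen.
    move=> B BA clB c cm; apply: contrapT => ncy; apply: H.
    by exists B; do 2?split=> //; exists c.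
  have : \forall z \near y, moved (rho c) z.
    exact: near_clopen (moved_clopen hu2 _) ncy.
  apply: filterS => z cz hz; apply: cz.
  exact: (germ3_on_glue hu1 (subgroup_stab rho z) hz ijk clB (tA B BA) cm).
rewrite -[X in closed X]setCK; apply: open_closedC; rewrite openE => y /= nYy.
have hy : germ3_on (St y) setT by apply: contrapT.
have := @stab_moves_near y setT closedT
  (fun x _ => stab_moves hy openT (I : setT x)).
apply: filterS => z hz Yz; have [c cz] := hz (q z) I.
by apply; exact: stab_fixes_q.
Qed.

Let q_cont y : Y y -> {for y, continuous q}.
Proof.
move=> Yy O; rewrite nbhsE => -[B [oB By] BO].
have oq : open (~` [set q y]).
  apply: closed_openC; apply: accessible_closed_set1.
  exact: hausdorff_accessible (cantor_hausdorff hu1.1).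
have := @stab_moves_near y (~` B) (open_closedC oB)
  (fun x Bx => stab_moves (q_off (y := y)) oq
     (fun xq => Bx (eq_ind_r B By xq))).
move=> /(filterI (near_clopen Y_clopen Yy)); apply: filterS => z [Yz hz].
apply: BO; apply: contrapT => nB; have [c cz] := hz _ nB.
by apply; exact: stab_fixes_q.
Qed.

(** Otherwise [rho] would kill a 3-cycle. *)
Let Y_nonempty : Y !=set0.
Proof.
apply: contrapT => nY.
have all y : germ3_on (St y) setT by apply: contrapT => Yy; apply: nY; exists y.
pose s : seq int := [:: 0; 1; 2].
have [A [clA Ax tA]] := small_clopen hu1.1 (small_tower hu1 s x1).
have {}tA := tA A (@subset_refl _ A).
have [c cm] : exists c : G, moves_tower u1 s (cycle3 0 1 2) A c.
  exact: cycle3_exists.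
have c1 : c = 1%g.
  apply: rho_inj; rewrite rho_one; apply: eq_full => y.
  exact: (germ3_on_glue hu1 (subgroup_stab rho y) (all y) _ clA tA cm).
have := cm.1 x1 0 Ax (mem_head _ _); rewrite c1 cycle3_fst pw0 => /esym.
by move/(pw_free hu1).
Qed.

(** The image of [q] is compact and contains an orbit. *)
Let q_surj x : exists2 y, Y y & q y = x.
Proof.
have compQ : compact (q @` Y).
  apply: continuous_compact.
    rewrite continuous_open_subspace; last by case: Y_clopen.
    by move=> y /set_mem; exact: q_cont.
  by apply: (subclosed_compact _ (cantor_compact hu2.1)) => //; case: Y_clopen.
have closedQ : closed (q @` Y).
  exact: compact_closed (cantor_hausdorff hu1.1) compQ.
apply: contrapT => nx; have [y Yy] := Y_nonempty.
have [|n] := min_dense hu1 (A := ~` (q @` Y)) (q y) (closed_openC closedQ).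
  by exists x => -[z Yz zx]; apply: nx; exists z.
apply; exists (rho (full_pw u1 n) y); first exact: Y_stable.
by rewrite q_equiv.
Qed.

Lemma factor_of_embedding : exists v : full_group u2,
  exists q : X2 -> X1, [/\ forall y, moved v y -> {for y, continuous q},
    forall y, moved v y -> u1 (q y) = q (v y) &
    forall x, exists2 y, moved v y & q y = x].
Proof.
pose f (g : G) (y : X2) := if `[< Y y >] then rho g y else y.
have f_in g y : Y y -> f g y = rho g y by rewrite /f => /asboolP->.
have f_out g y : ~ Y y -> f g y = y by rewrite /f => /asboolPn/negPf->.
have fK g h : (g * h = 1)%g -> cancel (f h) (f g).
  move=> gh y; have [Yy|Yy] := pselect (Y y); last by rewrite !f_out.
  by rewrite (f_in h) // f_in ?Y_stable -?rhoM ?gh ?rho1 //; exact: Y_stable.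
pose t := full_pw u1 1.
have [||y|v vE] := @full_of_fun _ u2 (f t) (f (t^-1)%g).
- by apply: fK; rewrite mulVg.
- by apply: fK; rewrite mulgV.
- have [Yy|Yy] := pselect (Y y).
    have [n tn] := full_groupP (rho t) y; exists n.
    by apply: filterS2 (near_clopen Y_clopen Yy) tn => z Yz <-; exact: f_in.
  exists 0; have : \forall z \near y, (~` Y) z.
    by apply: near_clopen => //; apply: clopen_setC; exact: Y_clopen.
  by apply: filterS => z; exact: f_out.
have qt y : Y y -> q (v y) = u1 (q y).
  by move=> Yy; rewrite vE f_in // q_equiv //= expg1.
have vY : moved v = Y.
  apply/seteqP; split=> y.
    by move=> vy; apply: contrapT => Yy; apply: vy; rewrite vE f_out.
  move=> Yy vy; have : pw 1 (q y) = q y by rewrite /= expg1 -qt // vy.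
  by move/(pw_free hu1).
by exists v, q; rewrite vY; split=> // y Yy; rewrite qt.
Qed.

End FactorOfEmbedding.

Theorem theorem1p8 (X1 X2 : topologicalType) (u1 : homeo X1) (u2 : homeo X2)
    (hu1 : cantor_minimal u1) (hu2 : cantor_minimal u2) :
  group_embeds (full_group u1) (full_group u2) <->
  exists v : full_group u2, factors_onto (Supp_map v) u1.
Proof.
have [f _] := hu1; have [_ [_ [g _]]] := f.
pose x1 : X1 := g point.
split=> [[rho rho_inj]|[v /(factors_ontoP hu2 v x1) [q [q_cont q_equiv q_surj]]]].
  have [v vq] := factor_of_embedding hu1 hu2 x1 rho_inj.
  by exists v; apply/(factors_ontoP hu2 v x1).
exact: (embedding_of_factor hu1 hu2 q_cont q_equiv q_surj).
Qed.
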